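(* Let $\mathcal{E}$ be a class of superreflexive Banach spaces that satisfies $(\mathrm{U})$ (stability under metric ultraproducts, defined in the context). Let $G$ be a finitely generated group and let $\Pi\leqslant\mathrm{Aut}(G)$ be a finite subgroup. (1) (Two-subgroup case) Let $M,L\leqslant G$ be subgroups such that $M\cup L$ generates $G$ and such that the player has a winning strategy for the $(\mathrm{Game}^{+})$ for $(M,L,\Pi)$ (defined in the context). If $G\geqslant M$ and $G\geqslant L$ have relative property $(\mathrm{F}_{\mathcal{E}})$, then $G$ has property $(\mathrm{F}_{\mathcal{E}})$. (2) (General case) Let $l\geq 3$ be an integer and let $M_1,\ldots,M_l\leqslant G$ be subgroups such that $\bigcup_{i=1}^{l}M_i$ generates $G$ and such that the player has a winning strategy for the $(\mathrm{Game}_l^{+})$ for $(M_1,\ldots,M_l,\Pi)$ (defined in the context). If $G\geqslant M_i$ has relative property $(\mathrm{F}_{\mathcal{E}})$ for all $1\leq i\leq l$, then $G$ has property $(\mathrm{F}_{\mathcal{E}})$.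
   Context: All group actions on metric spaces (in particular on Banach spaces) are by isometries, not assumed linear. For an action $\alpha\colon \Lambda\curvearrowright E$ and $M\leqslant \Lambda$, $E^{\alpha(M)}$ is the set of points fixed by $\alpha(h)$ for all $h\in M$. For a countable group $\Lambda$ and $M\leqslant\Lambda$, the pair $\Lambda\geqslant M$ has relative property $(\mathrm{F}_{\mathcal{E}})$ if $E^{\alpha(M)}\neq\emptyset$ for every $E\in\mathcal{E}$ and every action $\alpha\colon\Lambda\curvearrowright E$; a finitely generated group $G$ has property $(\mathrm{F}_{\mathcal{E}})$ if $G\geqslant G$ has relative property $(\mathrm{F}_{\mathcal{E}})$. A Banach space is superreflexive if and only if it is (linearly) isomorphic to some uniformly convex Banach space. A Banach space is uniformly convex if there is $\delta\colon(0,2]\to\mathbb{R}_{>0}$ such that $1-\|\xi+\eta\|/2\geq\delta(\|\xi-\eta\|)$ for all $\xi\ne\eta$ with $\|\xi\|=\|\eta\|=1$. $(\mathrm{U})$: there is a non-principal ultrafilter $\mathcal{U}$ on $\mathbb{N}$ such that for all $X_n\in\mathcal{E}$ and $w_n\in X_n$ ($n\in\mathbb{N}$), the pointed metric ultraproduct $\lim_{\mathcal{U}}(X_n,w_n)$ belongs to $\mathcal{E}$ (after forgetting the base point), where $\lim_{\mathcal{U}}(X_n,d_n,w_n)$ is the quotient of $\{(x_n)_n\in\prod X_n:\sup_n d_n(x_n,w_n)<\infty\}$ with semi-metric $\lim_{\mathcal{U}}d_n(x_n,y_n)$ by the relation of being at distance $0$. The $(\mathrm{Game}^{+})$ for $(M,L,\Pi)$: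 a one-player game with $M,L,\Pi$ fixed and two subgroups $H_1,H_2\leqslant G$ varying stage by stage. Initially $H_1=M$, $H_2=L$. At each stage the player may perform one of the following moves. - Type $(\mathrm{I}^{+})$ move: pick a subset $P\subseteq G$ such that $hH_1h^{-1}\geqslant M$ and $hH_2h^{-1}\geqslant L$ for all $h\in P$. Then replace $H_1$ by $\langle H_1,P\rangle$ and $H_2$ by $\langle H_2,P\rangle$. - Type $(\mathrm{II}_{\sigma})$ move, for $\sigma\in\mathrm{Sym}(2)$: pick a subset $\Lambda\subseteq\mathrm{Inn}(G)\cdot\Pi$ such that $H_{\sigma^{-1}(1)}\geqslant\phi(M)$ and $H_{\sigma^{-1}(2)}\geqslant\phi(L)$ for all $\phi\in\Lambda$. Then simultaneously replace $H_1$ by $\langle H_1,\bigcup_{\phi\in\Lambda}\phi(H_{\sigma(1)})\rangle$ and $H_2$ by $\langle H_2,\bigcup_{\phi\in\Lambda}\phi(H_{\sigma(2)})\rangle$. The player wins if after finitely many moves $H_1=G$ or $H_2=G$. The $(\mathrm{Game}_l^{+})$ for $(M_1,\ldots,M_l,\Pi)$: a one-player game with $M_1,\ldots,M_l,\Pi$ fixed and subgroups $H_1,\ldots,H_l\leqslant G$ varying stage by stage. Initially $H_i=M_i$ for all $i$. At each stage the player may perform one of the following moves. - Type $(\mathrm{I}_{\tau,l}^{+})$ move, for a permutation $\tau\in\mathrm{Sym}(l)$ of $\{1,\dots,l\}$ having at least one fixed point: pick $P\subseteq G$ such that $hH_ih^{-1}\geqslant M_{\tau(i)}$ for all $h\in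 P$ and all $1\le i\le l$. Then replace $H_i$ by $\langle H_i,P\rangle$ for every $i$ with $\tau(i)=i$, and keep $H_j$ for all other indices $j$. - Type $(\mathrm{II}_{\sigma,l})$ move, for $\sigma\in\mathrm{Sym}(l)$: pick $\Lambda\subseteq\mathrm{Inn}(G)\cdot\Pi$ such that $H_i\geqslant\phi(M_{\sigma(i)})$ for all $\phi\in\Lambda$ and all $1\le i\le l$. Then simultaneously replace each $H_i$, $1\le i\le l$, by $\langle H_i,\bigcup_{\phi\in\Lambda}\phi(H_{\sigma(i)})\rangle$. The player wins if after finitely many moves $H_i=G$ for some $i$. *)

(* Defs.v *)
From HB Require Import structures.
From mathcomp Require Import all_boot all_order all_algebra all_fingroup.
From mathcomp Require Import all_classical all_reals all_analysis.
From mathcomp Require Import generic_quotient.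
From Stdlib Require Import Relation_Operators.

Set Implicit Arguments.
Unset Strict Implicit.
Unset Printing Implicit Defensive.

Import Order.TTheory GRing.Theory Num.Theory.
Import numFieldNormedType.Exports.

Local Open Scope classical_set_scope.
Local Open Scope ring_scope.
Local Open Scope quotient_scope.

Section Groups.
Context {G : groupType}.
Implicit Types (A H : set G) (Pi : set (G -> G)).

Definition is_subgroup H : Prop :=
  H 1%g /\ forall x y, H x -> H y -> H (x * y^-1)%g.

Definition gen_subgroup A : set G := smallest is_subgroup A.

Definition conj_by (g x : G) : G := (g * x * g^-1)%g.

Definition group_Aut : set (G -> G) :=
  [set phi | bijective phi /\ forall x y, phi (x * y)%g = (phi x * phi y)%g].

Definition group_Inn : set (G -> G) := range conj_by.

Definition Inn_mul Pi : set (G -> G) :=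
  [set c \o phi | c in group_Inn & phi in Pi].

Definition is_finite_Aut_subgroup Pi : Prop :=
  [/\ finite_set Pi, Pi `<=` group_Aut, Pi id,
      forall phi psi, Pi phi -> Pi psi -> Pi (phi \o psi)
    & forall phi psi, Pi phi -> cancel phi psi -> cancel psi phi -> Pi psi].

End Groups.

Definition finitely_generated (G : groupType) : Prop :=
  exists2 A : set G, finite_set A & gen_subgroup A = setT.

Section Games.
Context {G : groupType}.

(* A position is the family of the current subgroups, indexed from 0; the
   family [K] of initial subgroups stays fixed throughout the game. *)

Inductive game2_move (K : 'I_2 -> set G) (Pi : set (G -> G))
    (H : 'I_2 -> set G) : ('I_2 -> set G) -> Prop :=
| Game2I (P : set G) :
    (forall h, P h -> forall i, K i `<=` conj_by h @` H i) ->
    game2_move K Pi H (fun i => gen_subgroup (H i `|` P))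
| Game2II (sigma : 'S_2) (Lambda : set (G -> G)) :
    Lambda `<=` Inn_mul Pi ->
    (forall phi, Lambda phi ->
       forall i, phi @` K i `<=` H ((sigma^-1)%g i)) ->
    game2_move K Pi H (fun i =>
      gen_subgroup (H i `|` \bigcup_(phi in Lambda) (phi @` H (sigma i)))).

Inductive game_move (l : nat) (K : 'I_l -> set G) (Pi : set (G -> G))
    (H : 'I_l -> set G) : ('I_l -> set G) -> Prop :=
| GameI (tau : 'S_l) (P : set G) :
    (exists i, tau i = i) ->
    (forall h, P h -> forall i, K (tau i) `<=` conj_by h @` H i) ->
    game_move K Pi H (fun i =>
      if tau i == i then gen_subgroup (H i `|` P) else H i)
| GameII (sigma : 'S_l) (Lambda : set (G -> G)) :
    Lambda `<=` Inn_mul Pi ->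
    (forall phi, Lambda phi -> forall i, phi @` K (sigma i) `<=` H i) ->
    game_move K Pi H (fun i =>
      gen_subgroup (H i `|` \bigcup_(phi in Lambda) (phi @` H (sigma i)))).

(* Since there is only one player, a winning strategy is a finite sequence of
   legal moves leading to a winning position. *)
Definition winnable (l : nat) (move : ('I_l -> set G) -> ('I_l -> set G) -> Prop)
    (K : 'I_l -> set G) : Prop :=
  exists H, clos_refl_trans _ move K H /\ exists i, H i = setT.

Definition set_pair (M L : set G) : 'I_2 -> set G :=
  fun i => if i == ord0 then M else L.

Definition game2_winnable (M L : set G) (Pi : set (G -> G)) : Prop :=
  winnable (game2_move (set_pair M L) Pi) (set_pair M L).

Definition game_winnable (l : nat) (M : 'I_l -> set G) (Pi : set (G -> G)) :
    Prop :=
  winnable (game_move M Pi) M.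

End Games.

Definition uniformly_convex (R : realType) (V : normedModType R) : Prop :=
  exists delta : R -> R, (forall t, 0 < t <= 2 -> 0 < delta t) /\
    forall x y : V, x != y -> `|x| = 1 -> `|y| = 1 ->
      1 - `|x + y| / 2 >= delta `|x - y|.

Definition superreflexive (R : realType) (V : completeNormedModType R) : Prop :=
  exists (W : completeNormedModType R)
         (T : {linear V -> W}) (S : {linear W -> V}),
    [/\ cancel T S, cancel S T, continuous T, continuous S
      & uniformly_convex W].

(* Normed spaces are regarded as metric spaces for the norm distance. *)

Section BoundedSequences.
Context {R : realType} {X : nat -> normedModType R}.

Record bounded_seq (w : forall n, X n) := BoundedSeq {
  bounded_seq_val :> forall n, X n;
  bounded_seqP : exists r : R, forall n, `|bounded_seq_val n - w n| <= r
}.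

HB.instance Definition _ w := gen_eqMixin (bounded_seq w).
HB.instance Definition _ w := gen_choiceMixin (bounded_seq w).

Definition ultra_semidist (U : set_system nat) (w : forall n, X n)
    (x y : bounded_seq w) : R := lim (`|x n - y n| @[n --> U]).

End BoundedSequences.

Section UltraproductTheory.
Context {R : realType} {X : nat -> normedModType R}.
Variables (U : set_system nat) (UF : UltraFilter U) (w : forall n, X n).
Implicit Types x y z : bounded_seq w.

Lemma ultra_bounded_cvg (f : nat -> R) (r : R) :
  (forall n, `|f n| <= r) -> cvg (f n @[n --> U]).
Proof.
move=> fr.
have fU : UltraFilter (f @ U).
  split; first exact: fmap_proper_filter.
  move=> H HF sub; apply/seteqP; split => // A HA.
  have [//|nA] := in_ultra_setVsetC (f @^-1` A) UF.
  have /sub HnA : (f @ U) (~` A) by [].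
  by have [t []] := @filter_ex _ H HF _ (filterI HA HnA).
have seg : (f @ U) [set` `[- r, r]].
  by apply: (@filterE _ U) => n /=; rewrite in_itv /= -ler_norml.
have := @segment_compact R (- r) r; rewrite compact_ultra => /(_ _ fU seg) [].
by move=> l [_ fl]; apply/cvg_ex; exists l.
Qed.

Lemma ultra_semidist_cvg x y :
  `|x n - y n| @[n --> U] --> ultra_semidist U x y.
Proof.
have [[r xr] [s ys]] := (bounded_seqP x, bounded_seqP y).
apply: (@ultra_bounded_cvg _ (r + s)) => n.
rewrite normr_id (le_trans (ler_distD (w n) _ _))// lerD//.
by rewrite distrC.
Qed.

Lemma ultra_semidistxx x : ultra_semidist U x x = 0.
Proof.
rewrite /ultra_semidist; under eq_fun do rewrite subrr normr0.
exact: lim_cst.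
Qed.

Lemma ultra_semidistC x y : ultra_semidist U x y = ultra_semidist U y x.
Proof. by rewrite /ultra_semidist; under eq_fun do rewrite distrC. Qed.

Lemma ultra_semidistD y x z :
  ultra_semidist U x z <= ultra_semidist U x y + ultra_semidist U y z.
Proof.
have xyz : (`|x n - y n| + `|y n - z n|) @[n --> U] -->
    ultra_semidist U x y + ultra_semidist U y z.
  by apply: cvgD; exact: ultra_semidist_cvg.
rewrite -(cvg_lim (@Rhausdorff R) xyz); apply: ler_lim.
- by apply/cvg_ex; exists (ultra_semidist U x z); exact: ultra_semidist_cvg.
- by apply/cvg_ex; eexists; exact: xyz.
- by apply: filterE => n /=; exact: ler_distD.
Qed.

Lemma ultra_semidist_ge0 x y : 0 <= ultra_semidist U x y.
Proof.
rewrite -(pmulr_rge0 _ (ltr0Sn R 1)) -(ultra_semidistxx x) mulr_natl mulr2n.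
by rewrite {2}ultra_semidistC ultra_semidistD.
Qed.

Definition ultra_eq : rel (bounded_seq w) :=
  fun x y => ultra_semidist U x y == 0.

Lemma ultra_eq_refl : reflexive ultra_eq.
Proof. by move=> x; rewrite /ultra_eq ultra_semidistxx. Qed.

Lemma ultra_eq_sym : symmetric ultra_eq.
Proof. by move=> x y; rewrite /ultra_eq ultra_semidistC. Qed.

Lemma ultra_eq_trans : transitive ultra_eq.
Proof.
move=> y x z /eqP xy /eqP yz; rewrite /ultra_eq eq_le ultra_semidist_ge0 andbT.
by rewrite (le_trans (ultra_semidistD y x z))// xy yz addr0.
Qed.

Canonical ultra_equiv : equiv_rel (bounded_seq w) :=
  EquivRel ultra_eq ultra_eq_refl ultra_eq_sym ultra_eq_trans.

End UltraproductTheory.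

Definition ultraproduct (R : realType) (X : nat -> normedModType R)
    (U : set_system nat) (UF : UltraFilter U) (w : forall n, X n) : Type :=
  {eq_quot (ultra_equiv UF w)}.

Section UltraproductMetric.
Context {R : realType} {X : nat -> normedModType R}.
Variables (U : set_system nat) (UF : UltraFilter U) (w : forall n, X n).
Local Notation Z := (ultraproduct UF w).

HB.instance Definition _ := Choice.on Z.
HB.instance Definition _ := EqQuotient.on Z.

Definition ultra_dist (a b : Z) : R := ultra_semidist U (repr a) (repr b).

Lemma ultra_piP (x y : bounded_seq w) :
  \pi_Z x = \pi_Z y <-> ultra_semidist U x y = 0.
Proof.
by split => [/(@eqmodP _ (ultra_equiv UF w))/eqP|/eqP xy] //;
  apply/(@eqmodP _ (ultra_equiv UF w)).
Qed.

Lemma ultra_dist_pi (x y : bounded_seq w) :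
  ultra_dist (\pi_Z x) (\pi_Z y) = ultra_semidist U x y.
Proof.
have rep z : ultra_semidist U z (repr (\pi_Z z)) = 0.
  by apply/ultra_piP; rewrite reprK.
have D b a c := @ultra_semidistD _ _ _ UF w b a c.
rewrite /ultra_dist; apply/eqP; rewrite eq_le; apply/andP; split.
- rewrite (le_trans (D x _ _))// ultra_semidistC rep add0r.
  by rewrite (le_trans (D y _ _))// rep addr0.
- rewrite (le_trans (D (repr (\pi_Z x)) _ _))// rep add0r.
  rewrite (le_trans (D (repr (\pi_Z y)) _ _))//.
  by rewrite (ultra_semidistC _ (repr (\pi_Z y)) y) rep addr0.
Qed.

Lemma ultra_distxx a : ultra_dist a a = 0.
Proof. exact: ultra_semidistxx. Qed.

Lemma ultra_dist_positivity a b : ultra_dist a b = 0 -> a = b.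
Proof.
move=> ab; rewrite -(reprK a) -(reprK b).
exact/ultra_piP.
Qed.

Lemma ultra_dist_sym a b : ultra_dist a b = ultra_dist b a.
Proof. exact: ultra_semidistC. Qed.

Lemma ultra_dist_triangle b a c :
  ultra_dist a c <= ultra_dist a b + ultra_dist b c.
Proof. exact: ultra_semidistD. Qed.

HB.instance Definition _ := isMetric.Build R Z
  ultra_distxx ultra_dist_positivity ultra_dist_sym ultra_dist_triangle.

End UltraproductMetric.

(* The ultraproduct is only a metric space (its base point, hence any origin,
   is forgotten), so its membership in a class of Banach spaces means that it
   is, as a metric space, one of the spaces of the class. *)
Definition metric_mem (R : realType) (E : completeNormedModType R -> Prop)
    (Z : metricType R) : Prop :=
  exists2 B : completeNormedModType R, E B &
    exists2 f : Z -> B, bijective f & forall x y, `|f x - f y| = mdist x y.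

Definition ultraproduct_stable (R : realType)
    (E : completeNormedModType R -> Prop) : Prop :=
  exists (U : set_system nat) (UF : UltraFilter U),
    (forall n, U <> principal_filter n) /\
    forall X : nat -> completeNormedModType R, (forall n, E (X n)) ->
      forall w : forall n, X n,
        metric_mem E (@ultraproduct R X U UF w).

Definition isometric_action (R : realType) (G : groupType)
    (V : normedModType R) (alpha : G -> V -> V) : Prop :=
  [/\ forall x, alpha 1%g x = x,
      forall g h x, alpha (g * h)%g x = alpha g (alpha h x)
    & forall g x y, `|alpha g x - alpha g y| = `|x - y|].

Definition fixed_points (G : groupType) (T : Type) (alpha : G -> T -> T)
    (M : set G) : set T :=
  [set x | forall h, M h -> alpha h x = x].

Definition relative_property_F (R : realType)
    (E : completeNormedModType R -> Prop) (G : groupType) (M : set G) : Prop :=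
  forall B : completeNormedModType R, E B ->
    forall alpha : G -> B -> B, isometric_action alpha ->
      fixed_points alpha M !=set0.

Definition property_F (R : realType) (E : completeNormedModType R -> Prop)
    (G : groupType) : Prop :=
  relative_property_F E [set: G].

(* Main.v *)
(** Suppose that [alpha] is an action on [V] in the class [E].  It is affine by
    the Mazur-Ulam theorem, and its linear part preserves an equivalent norm
    which is uniformly convex.  Among the families of points fixed by the [M i],
    minimize the sum of the squared mutual distances; the minimum is reached
    by "generalized points", i.e. pointwise limits of the cocycles
    [g |-> alpha g x - x], and by uniform convexity the minimizing family is
    unique.  Do this for all the twisted actions [alpha \o psi] with [psi] in
    [Pi].  A legal move turns minimizing families into minimizing families, so
    that throughout the game each [H i] fixes the [i]-th minimizing generalized
    point; in a type (I) move the elements of [P] move it by a vector [v] fixed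
    by the linear part, and [v = 0] because [v] is also a sum of
    vectors [pi g x - x].  When the game is won, the whole group fixes a
    generalized point, which means that [alpha] has almost fixed points.
    On the other hand, if some [alpha] had no fixed point, then by the
    Gromov-Schoen argument a limit of rescalings of [alpha], acting on an
    ultrapower of [V], would have no almost fixed points. *)
Require Import Defs.
From mathcomp Require Import all_boot all_order all_algebra all_fingroup.
From mathcomp Require Import all_classical all_reals all_analysis.
From mathcomp Require Import generic_quotient lra.

Set Implicit Arguments.
Unset Strict Implicit.
Unset Printing Implicit Defensive.

Import Order.TTheory GRing.Theory Num.Theory.
Import numFieldNormedType.Exports.

Local Open Scope classical_set_scope.
Local Open Scope ring_scope.

Lemma gen_subgroup_full (G : groupType) (A H : set G) :
  gen_subgroup A = [set: G] -> is_subgroup H -> A `<=` H -> forall g, H g.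
Proof.
move=> AT H_sub AH g; have := @smallest_sub _ is_subgroup A H H_sub AH g.
by rewrite -/(gen_subgroup A) AT; exact.
Qed.

(** * The Mazur-Ulam theorem *)

Lemma pow2_gt (R : realType) (e C : R) : 0 < e -> exists n, C < 2 ^+ n * e.
Proof.
move=> e0; exists (Num.truncn (C / e)).+1; rewrite -ltr_pdivrMr//.
by rewrite (lt_trans (truncnS_gt _))// -natrX ltr_nat ltn_expl.
Qed.

Section Midpoint.
Context {R : realType} {V : normedModType R}.
Implicit Types (f g : V -> V) (x y z : V).

Definition mid x y : V := 2^-1 *: (x + y).

Lemma double_mid x y : mid x y + mid x y = x + y.
Proof.
by rewrite -scalerDl (_ : _ + _ = 1) ?scale1r//; lra.
Qed.

Lemma mid2 z x y : z + z = x + y -> z = mid x y.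
Proof.
by move=> zxy; rewrite /mid -zxy scalerDr -scalerDl (_ : _ + _ = 1) ?scale1r//; lra.
Qed.

Lemma midC x y : mid x y = mid y x.
Proof. by rewrite /mid addrC. Qed.

Lemma mid_self x : mid x x = x.
Proof. by rewrite -(mid2 (erefl (x + x))). Qed.

Lemma midB x y x' y' : mid x y - mid x' y' = mid (x - x') (y - y').
Proof. by rewrite /mid -scalerBr opprD addrACA. Qed.

Lemma norm_double x : `|x + x| = 2 * `|x|.
Proof. by rewrite -mulr2n normrMn mulr_natl. Qed.

Definition point_refl z x : V := (z + z) - x.

Lemma point_reflK z : involutive (point_refl z).
Proof. by move=> x; rewrite /point_refl opprB addrC subrK. Qed.

Lemma point_refl_iso z x y : `|point_refl z x - point_refl z y| = `|x - y|.
Proof. by rewrite /point_refl opprB addrC addrA subrK distrC. Qed.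

Lemma point_refl_fix z : point_refl z z = z.
Proof. exact: addrK. Qed.

Lemma point_refl_mid x y : point_refl (mid x y) x = y.
Proof. by rewrite /point_refl double_mid addrC addrA addNr add0r. Qed.

Lemma point_refl_midr x y : point_refl (mid x y) y = x.
Proof. by rewrite midC point_refl_mid. Qed.

Lemma point_refl_dist z x : `|point_refl z x - x| = 2 * `|x - z|.
Proof.
rewrite -norm_double -[LHS]normrN; congr `|_|.
by rewrite /point_refl opprB opprB addrA opprD addrACA addrA.
Qed.

(* Vaisala's proof of the Mazur-Ulam theorem: from an isometry [f] fixing [x]
   and [y] one builds another one moving the midpoint twice as far, whereas
   the displacement of the midpoint is bounded for all of them. *)
Lemma isometry_fix_mid n f g x y : cancel f g -> cancel g f ->
  (forall a b, `|f a - f b| = `|a - b|) -> f x = x -> f y = y ->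
  2 ^+ n * `|f (mid x y) - mid x y| <= 2 * `|mid x y - x|.
Proof.
set z := mid x y.
elim: n f g => [|n IH] f g fK gK f_iso fx fy.
  rewrite expr0 mul1r (le_trans (ler_distD x _ _))// -{1}fx f_iso.
  by rewrite distrC mulr_natl mulr2n.
have g_iso a b : `|g a - g b| = `|a - b| by rewrite -f_iso !gK.
have gx : g x = x by rewrite -{1}fx fK.
have gy : g y = y by rewrite -{1}fy fK.
have rK := point_reflK z.
rewrite exprSr -mulrA.
have <- : `|(point_refl z \o g \o point_refl z \o f) z - z| = 2 * `|f z - z|.
  by rewrite -point_refl_dist -[in RHS]g_iso fK -[RHS](point_refl_iso z) point_refl_fix.
apply: (IH _ (g \o point_refl z \o f \o point_refl z)).
- by move=> a /=; rewrite rK gK rK fK.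
- by move=> a /=; rewrite gK rK fK rK.
- by move=> a b /=; rewrite !(point_refl_iso, g_iso, f_iso) /=.
- by rewrite /= fx point_refl_mid gy point_refl_midr.
- by rewrite /= fy point_refl_midr gx point_refl_mid.
Qed.

(** The map [h], composed of [f], its inverse and the two reflections, fixes [x] and [y]; the bound
    of [isometry_fix_mid], valid for every [n], makes it fix [z]. Hence [f z] is fixed by the
    reflection in [z'], whose only fixed point is [z']. *)
Lemma isometry_mid f g x y : cancel f g -> cancel g f ->
  (forall a b, `|f a - f b| = `|a - b|) -> f (mid x y) = mid (f x) (f y).
Proof.
move=> fK gK f_iso; set z := mid x y; set z' := mid (f x) (f y).
have g_iso a b : `|g a - g b| = `|a - b| by rewrite -f_iso !gK.
have [rK r'K] := (point_reflK z, point_reflK z').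
pose h := point_refl z \o g \o point_refl z' \o f.
have hz : h z = z.
  apply/eqP; rewrite -subr_eq0 -[_ == 0]negbK; apply/negP.
  rewrite -normr_gt0 => /(pow2_gt (2 * `|z - x|)) [n].
  rewrite ltNge (@isometry_fix_mid n h (g \o point_refl z' \o f \o point_refl z))//.
  - by move=> a; rewrite /h /= rK gK r'K fK.
  - by move=> a; rewrite /h /= gK r'K fK rK.
  - by move=> a b; rewrite /h !(point_refl_iso, g_iso, f_iso) /=.
  - by rewrite /h /= point_refl_mid fK point_refl_midr.
  - by rewrite /h /= point_refl_midr fK point_refl_mid.
have r'fz : point_refl z' (f z) = f z.
  by apply: (can_inj gK); apply: (can_inj rK); rewrite -[LHS]/(h z) hz fK point_refl_fix.
have := point_refl_dist z' (f z); rewrite r'fz subrr normr0 => /esym/eqP.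
by rewrite mulf_eq0 pnatr_eq0/= normr_eq0 subr_eq0 => /eqP.
Qed.

End Midpoint.

(** * Isometric representations and uniformly convex functionals *)

Lemma cauchy_seq_cvg (R : realType) (V : completeNormedModType R) (u : nat -> V) :
  (forall e, 0 < e -> exists N, forall m n, (N <= m)%N -> (N <= n)%N ->
    `|u m - u n| <= e) -> cvg (u n @[n --> \oo]).
Proof.
move=> u_cauchy; apply/cauchy_cvgP/cauchy_exP => e e0.
have [|N uN] := u_cauchy (e / 2); first by lra.
exists (u N); exists N => // n /= Nn.
by rewrite -ball_normE /= (le_lt_trans (uN _ _ (leqnn N) Nn))//; lra.
Qed.

Section Representation.
Context {R : realType} {V : completeNormedModType R} {G : groupType}.
Implicit Types (pi : G -> V -> V) (g h : G) (x y w : V) (q : V -> R).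

Definition isometric_rep pi : Prop :=
  [/\ forall x, pi 1%g x = x,
      forall g h x, pi (g * h)%g x = pi g (pi h x),
      forall g x y, pi g (x + y) = pi g x + pi g y
    & forall g x, `|pi g x| = `|x| ].

Definition linear_part (alpha : G -> V -> V) g x : V := alpha g x - alpha g 0.

Section Action.
Variables (alpha : G -> V -> V) (act : isometric_action alpha).

Lemma actK g : cancel (alpha g) (alpha g^-1%g).
Proof. by case: act => a1 aM _ x; rewrite -aM mulVg a1. Qed.

Lemma actVK g : cancel (alpha g^-1%g) (alpha g).
Proof. by case: act => a1 aM _ x; rewrite -aM mulgV a1. Qed.

Lemma act_mid g x y : alpha g (mid x y) = mid (alpha g x) (alpha g y).
Proof. by case: act => _ _ ai; exact: isometry_mid (actK g) (actVK g) (ai g). Qed.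

(** Affinity of [alpha g]: [mid x y] is also the midpoint of [x + y] and [0]. *)
Lemma act_add g x y : alpha g (x + y) + alpha g 0 = alpha g x + alpha g y.
Proof. by rewrite -double_mid -act_mid /mid addr0 -/(mid x y) act_mid double_mid. Qed.

Lemma actB g x y : alpha g x - alpha g y = linear_part alpha g (x - y).
Proof.
have := act_add g (x - y) y; rewrite subrK => E.
by rewrite -(addrK (alpha g 0) (alpha g x)) E addrAC addrK.
Qed.

Lemma linear_part_rep : isometric_rep (linear_part alpha).
Proof.
case: act => a1 aM ai; split.
- by move=> x; rewrite /linear_part !a1 subr0.
- by move=> g h x; rewrite /linear_part !aM actB.
- move=> g x y; rewrite /linear_part -(addrK (alpha g 0) (alpha g (x + y))).
  by rewrite act_add [RHS]addrACA addrA.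
- by move=> g x; rewrite ai subr0.
Qed.

End Action.
Section RepTheory.
Variables (pi : G -> V -> V) (rep : isometric_rep pi).

Lemma repD g x y : pi g (x + y) = pi g x + pi g y.
Proof. by case: rep. Qed.

Lemma rep_norm g x : `|pi g x| = `|x|.
Proof. by case: rep. Qed.

Lemma rep1 x : pi 1%g x = x.
Proof. by case: rep. Qed.

Lemma repM g h x : pi (g * h)%g x = pi g (pi h x).
Proof. by case: rep. Qed.

Lemma repVK g : cancel (pi g^-1%g) (pi g).
Proof. by move=> x; rewrite -repM mulgV rep1. Qed.

Lemma rep0 g : pi g 0 = 0.
Proof. by apply/eqP; rewrite -normr_eq0 rep_norm normr0. Qed.

Lemma repN g x : pi g (- x) = - pi g x.
Proof. by apply/eqP; rewrite -addr_eq0 -repD addNr rep0. Qed.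

Lemma repB g x y : pi g (x - y) = pi g x - pi g y.
Proof. by rewrite repD repN. Qed.

Lemma rep_mid g x y : pi g (mid x y) = mid (pi g x) (pi g y).
Proof. by apply: mid2; rewrite -!repD double_mid. Qed.

Lemma rep_cvg g (u : nat -> V) z : u n @[n --> \oo] --> z ->
  pi g (u n) @[n --> \oo] --> pi g z.
Proof.
move=> /cvgrPdist_le uz; apply/cvgrPdist_le => e e0.
by near=> n; rewrite -repB rep_norm; near: n; exact: uz.
Unshelve. all: by end_near. Qed.

End RepTheory.

(** Abstracts the square of an equivalent uniformly convex norm, as needed for minimization. *)
Record gauge q : Prop := Gauge {
  gauge_coercive : exists2 k, 0 < k & forall x, `|x| ^+ 2 <= k * q x;
  gauge_convex : forall C e, 0 < e -> exists2 d, 0 < d & forall x y,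
    `|x| <= C -> `|y| <= C -> e <= `|x - y| -> q (mid x y) + d <= (q x + q y) / 2;
  gauge_lipschitz : forall C, exists L, forall x y,
    `|x| <= C -> `|y| <= C -> q x - q y <= L * `|x - y|
}.

Section Gauge.
Variables (q : V -> R) (gq : gauge q).

Lemma gauge_ge0 x : 0 <= q x.
Proof.
have [k k0 kq] := gauge_coercive gq.
by rewrite -(pmulr_rge0 _ k0) (le_trans _ (kq x)).
Qed.

Lemma gauge_bounded c : exists C, forall x, q x <= c -> `|x| <= C.
Proof.
have [k k0 kq] := gauge_coercive gq.
exists (1 + k * c) => x xc.
have := le_trans (kq x) (ler_wpM2l (ltW k0) xc).
rewrite expr2; have := normr_ge0 x; case: (leP `|x| 1) => x1; first by nra.
nra.
Qed.

Lemma gauge_mid x y : q (mid x y) <= (q x + q y) / 2.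
Proof.
have [->|xy] := eqVneq x y; first by rewrite mid_self; lra.
have [|d d0] := @gauge_convex _ gq (Num.max `|x| `|y|) `|x - y|.
  by rewrite normr_gt0 subr_eq0.
move=> /(_ x y); rewrite !le_max !lexx orbT => /(_ isT isT isT); lra.
Qed.

Lemma gauge_cvg (u : nat -> V) z : u n @[n --> \oo] --> z ->
  q (u n) @[n --> \oo] --> q z.
Proof.
move=> uz; have [L qL] := gauge_lipschitz gq (`|z| + 1).
apply/cvgrPdist_le => e e0.
near=> n.
have unz : `|z - u n| <= Num.min 1 (e / (`|L| + 1)).
  near: n; move/cvgrPdist_le : uz; apply.
  by rewrite lt_min ltr01 divr_gt0// ltr_wpDl.
move: unz; rewrite le_min ler_pdivlMr ?ltr_wpDl// => /andP[un1 une].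
have zn : `|z| <= `|z| + 1 by rewrite lerDl.
have un : `|u n| <= `|z| + 1.
  by rewrite -[u n](subKr z) (le_trans (ler_normB _ _))// lerD2l.
have := qL _ _ zn un; have := qL _ _ un zn; rewrite (distrC (u n)).
have : L * `|z - u n| <= e.
  rewrite (le_trans _ une)// mulrC ler_wpM2l// (le_trans (ler_norm _))//.
  by rewrite lerDl.
by rewrite ler_norml; lra.
Unshelve. all: by end_near. Qed.

Section NearMin.
Variables (I : finType) (K : set (I -> V)).
Hypothesis K_mid : forall u v, K u -> K v -> K (fun i => mid (u i) (v i)).

(** If two near-minimizers were further than [e] apart at one index, convexity at that index would
    push their midpoint family, still in [K], below [m]. *)
Lemma near_min_close (m e : R) : 0 < e ->
  (forall u, K u -> m <= \sum_i q (u i)) ->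
  exists2 d, 0 < d & forall u v, K u -> K v ->
    \sum_i q (u i) <= m + d -> \sum_i q (v i) <= m + d ->
    forall i, `|u i - v i| <= e.
Proof.
move=> e0 mK; have [C qC] := gauge_bounded (m + 1).
have [d d0 dq] := gauge_convex gq C e0.
(* The [1] keeps near-minimizers in the ball of radius [C]; [d / 2] leaves the midpoint at least
   [d / 2] below [m]. *)
exists (Num.min 1 (d / 2)) => [|u v Ku Kv um vm i].
  by rewrite lt_min ltr01 divr_gt0.
have d1 : Num.min 1 (d / 2) <= 1 :> R by rewrite ge_min lexx.
have d2 : Num.min 1 (d / 2) <= d / 2 :> R by rewrite ge_min lexx orbT.
have bd (w : I -> V) : \sum_i q (w i) <= m + Num.min 1 (d / 2) -> `|w i| <= C.
  move=> wm; apply: qC; rewrite (bigD1 i)//= in wm.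
  have : 0 <= \sum_(j | j != i) q (w j) by apply: sumr_ge0 => j _; exact: gauge_ge0.
  lra.
rewrite leNgt; apply/negP => /ltW /(dq _ _ (bd _ um) (bd _ vm)) di.
have := mK _ (K_mid Ku Kv).
rewrite (bigD1 i)//=; rewrite (bigD1 i)//= in um; rewrite (bigD1 i)//= in vm.
have : \sum_(j | j != i) q (mid (u j) (v j)) <=
    (\sum_(j | j != i) q (u j) + \sum_(j | j != i) q (v j)) / 2.
  rewrite mulrDl !mulr_suml -big_split/=; apply: ler_sum => j _.
  by rewrite -mulrDl gauge_mid.
lra.
Qed.

(** [near_min_close] makes a minimizing sequence Cauchy. Its limit [z] need not lie in [K], so the
    sequence is returned too: data attached to members of [K] can then be passed to the limit. *)
Lemma min_sequence : K !=set0 -> exists m (u : nat -> I -> V) (z : I -> V),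
  [/\ forall n, K (u n), forall v, K v -> m <= \sum_i q (v i),
    forall n, \sum_i q (u n i) <= m + n.+1%:R^-1,
    forall i, u n i @[n --> \oo] --> z i
    & \sum_i q (z i) = m].
Proof.
move=> [u0 Ku0]; pose A := [set \sum_i q (v i) | v in K].
have A0 : has_inf A.
  split; first by exists (\sum_i q (u0 i)), u0.
  by exists 0 => _ [v _ <-]; apply: sumr_ge0 => i _; exact: gauge_ge0.
pose m := inf A.
have mK v : K v -> m <= \sum_i q (v i) by move=> Kv; apply: ge_inf; [case: A0|exists v].
have /choice [u uP] : forall n, exists v, K v /\ \sum_i q (v i) <= m + n.+1%:R^-1.
  move=> n.
  have [|_ [v Kv <-] vm] := @inf_adherent _ A n.+1%:R^-1 _ A0; first by [].
  by exists v; split => //; exact: ltW.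
have u_cvg i : cvg (u n i @[n --> \oo]).
  apply: cauchy_seq_cvg => e e0; have [d d0 dK] := near_min_close e0 mK.
  have [N _ Nd] := near_infty_natSinv_lt (PosNum d0).
  exists N => k n Nk Nn; have [Kk uk] := uP k; have [Kn un] := uP n.
  apply: dK => //.
    by rewrite (le_trans uk)// lerD2l; exact/ltW/Nd.
  by rewrite (le_trans un)// lerD2l; exact/ltW/Nd.
exists m, u, (fun i => lim (u n i @[n --> \oo])); split => //.
- by move=> n; have [] := uP n.
- by move=> n; have [] := uP n.
have qu : \sum_i q (u n i) @[n --> \oo] --> \sum_i q (lim (u n i @[n --> \oo])).
  apply: (cvg_big (op := +%R)) => [|i _]; first exact: add_continuous.
  by apply: gauge_cvg; exact: u_cvg.
apply: (cvg_unique _ qu) => //.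
suff mu (e : R) : 0 < e -> \forall n \near \oo, `|m - \sum_i q (u n i)| <= e.
  exact/cvgrPdist_le.
move=> e0; near=> n; have [Kn un] := uP n; have := mK _ Kn.
have : n.+1%:R^-1 < e by near: n; exact: (near_infty_natSinv_lt (PosNum e0)).
move: un; set t := _^-1; set s := \sum_i _ => *.
by rewrite ler_norml; apply/andP; split; lra.
Unshelve. all: by end_near. Qed.

End NearMin.
End Gauge.
End Representation.

(** * Fixed vectors and coboundaries *)

Section Drift.
Context {R : realType} {V : completeNormedModType R} {G : groupType}.
Implicit Types (pi : G -> V -> V) (g h : G) (N : V -> R).

(** An equivalent norm invariant under [pi]. Convexity is stated for squares and relative to their
    sum, so it is independent of scale and applies to vectors of different lengths. *)
Record unif_norm pi N : Prop := UnifNorm {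
  unif_norm_inv : forall g x, N (pi g x) = N x;
  unif_normD : forall x y, N (x + y) <= N x + N y;
  unif_normN : forall x, N (- x) = N x;
  unif_normMn : forall x n, N (x *+ n) = n%:R * N x;
  unif_norm_ge : exists2 k, 0 < k & forall x, `|x| <= k * N x;
  unif_norm_le : exists2 L, 0 < L & forall x, N x <= L * `|x|;
  unif_norm_convex : forall eta, 0 < eta -> exists2 c, 0 < c <= 1 & forall x y,
    eta * (N x ^+ 2 + N y ^+ 2) <= N (x - y) ^+ 2 ->
    N (mid x y) ^+ 2 <= (1 - c) * ((N x ^+ 2 + N y ^+ 2) / 2)
}.

Section UnifNorm.
Variables (pi : G -> V -> V) (N : V -> R).
Hypotheses (rep : isometric_rep pi) (uN : unif_norm pi N).

Lemma unif_norm0 : N 0 = 0.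
Proof. by rewrite -(mulr0n 0) (unif_normMn uN) mul0r. Qed.

Lemma unif_norm_ge0 x : 0 <= N x.
Proof.
have := unif_normD uN x (- x); rewrite subrr unif_norm0 (unif_normN uN); lra.
Qed.

Lemma unif_normB x y : N (x - y) <= N x + N y.
Proof. by rewrite (le_trans (unif_normD uN _ _))// (unif_normN uN). Qed.

Lemma unif_norm_sum (I : finType) (f : I -> V) : N (\sum_i f i) <= \sum_i N (f i).
Proof.
elim/big_ind2 : _ => [|x a y b xa yb|//]; first by rewrite unif_norm0.
by rewrite (le_trans (unif_normD uN _ _))// lerD.
Qed.

Lemma unif_norm_sqrB x y : N (x - y) ^+ 2 <= 2 * (N x ^+ 2 + N y ^+ 2).
Proof.
have /(lerXn2r 2) H := unif_normB x y.
rewrite (le_trans (H _ _))// ?nnegrE ?unif_norm_ge0 ?addr_ge0 ?unif_norm_ge0//.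
have := sqr_ge0 (N x - N y); lra.
Qed.

Lemma double_unif_norm_mid x y : 2 * N (mid x y) = N (x + y).
Proof. by rewrite -(unif_normMn uN) mulr2n double_mid. Qed.

Lemma unif_norm_mid x y : N (mid x y) ^+ 2 <= (N x ^+ 2 + N y ^+ 2) / 2.
Proof.
have : N (mid x y) <= (N x + N y) / 2.
  by have := unif_normD uN x y; rewrite -double_unif_norm_mid; lra.
move=> /(lerXn2r 2) H.
rewrite (le_trans (H _ _))// ?nnegrE ?unif_norm_ge0//.
  by rewrite divr_ge0 ?addr_ge0 ?unif_norm_ge0.
have := sqr_ge0 (N x - N y); lra.
Qed.

Lemma unif_norm_gauge : gauge (fun x => N x ^+ 2).
Proof.
have [k k0 kN] := unif_norm_ge uN; have [L L0 LN] := unif_norm_le uN.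
split=> [|C e e0|C].
- exists (k ^+ 2) => [|x]; first by rewrite exprn_gt0.
  by rewrite -exprMn lerXn2r ?nnegrE// mulr_ge0 ?(ltW k0)// unif_norm_ge0.
(* [B] bounds [N x ^+ 2 + N y ^+ 2] on the ball of radius [C]; the [1] makes it positive. *)
- pose B := 2 * (L * C) ^+ 2 + 1.
  have B0 : 0 < B by rewrite /B ltr_wpDl// mulr_ge0// sqr_ge0.
  have ek : 0 < e / k by rewrite divr_gt0.
  have [|c /andP[c0 c1] cN] := @unif_norm_convex _ _ uN ((e / k) ^+ 2 / B).
    by rewrite divr_gt0// exprn_gt0.
  (* [(e / k) ^+ 2 <= N (x - y) ^+ 2 <= 2 * (N x ^+ 2 + N y ^+ 2)] turns the relative gain [c] into
     this absolute one. *)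
  exists (c / 4 * (e / k) ^+ 2) => [|x y xC yC xy].
    by rewrite mulr_gt0// ?divr_gt0// exprn_gt0.
  have xyN : (e / k) ^+ 2 <= N (x - y) ^+ 2.
    rewrite lerXn2r ?nnegrE ?(ltW ek) ?unif_norm_ge0//.
    by rewrite ler_pdivrMr// mulrC (le_trans xy).
  have bnd x' : `|x'| <= C -> N x' ^+ 2 <= (L * C) ^+ 2.
    move=> x'C; have Nx' : N x' <= L * C.
      by rewrite (le_trans (LN _))// ler_wpM2l ?(ltW L0).
    by rewrite lerXn2r ?nnegrE ?unif_norm_ge0// (le_trans _ Nx')// unif_norm_ge0.
  have [xb yb] := (bnd _ xC, bnd _ yC).
  have /cN : (e / k) ^+ 2 / B * (N x ^+ 2 + N y ^+ 2) <= N (x - y) ^+ 2.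
    rewrite (le_trans _ xyN)// mulrAC ler_pdivrMr// ler_wpM2l ?sqr_ge0//.
    rewrite /B; lra.
  have := unif_norm_sqrB x y.
  move: xyN {cN xb yb bnd}; set E := (e / k) ^+ 2; nra.
exists (2 * L * (L * C)) => x y xC yC.
have Nxy : N x - N y <= L * `|x - y|.
  rewrite lerBlDr (le_trans _ (lerD (LN _) (lexx _)))//.
  by rewrite -{1}(subrK y x) (unif_normD uN).
have Nx : N x <= L * C by rewrite (le_trans (LN _))// ler_wpM2l ?(ltW L0).
have Ny : N y <= L * C by rewrite (le_trans (LN _))// ler_wpM2l ?(ltW L0).
have := unif_norm_ge0 x; have := unif_norm_ge0 y.
have : 0 <= L * `|x - y| by rewrite mulr_ge0// ltW.
rewrite (_ : _ * `|x - y| = 2 * (L * C) * (L * `|x - y|)); last by lra.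
move: Nxy Nx Ny; move: (L * `|x - y|) (L * C) => a b; move: (N x) (N y) => s t.
move=> st sb tb a0 t0 s0; have : (s - t) * (s + t) <= a * (s + t) by nra.
have : a * (s + t) <= a * (2 * b) by nra.
lra.
Qed.

(* Uniform convexity of [L^2], applied to the two halves of a martingale. *)
Lemma unif_norm_sum_growth : exists2 rho, 0 < rho < 1 &
  forall (I : finType) (x y : I -> V),
    \sum_i N (x i) ^+ 2 <= \sum_i N (x i - y i) ^+ 2 ->
    \sum_i N (x i + y i) ^+ 2 <=
      2 * rho * (\sum_i N (x i) ^+ 2 + \sum_i N (y i) ^+ 2).
Proof.
have [|c /andP[c0 c1] cN] := @unif_norm_convex _ _ uN 10^-1; first by rewrite invr_gt0.
(* With the sums named below, [X <= D] and [py] give [X + Y <= 5 * D], so the term [c * D] coming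
   from [pw] is at least twice the excess [c / 10 * (X + Y)]. *)
exists (1 - c / 20) => [|I x y]; first by lra.
(* For pairs closer than the threshold, the excess [c / 10] pays for the subtracted term; for the
   others the convexity gain does. *)
have pw i : N (x i + y i) ^+ 2 <=
    (2 + c / 10) * (N (x i) ^+ 2 + N (y i) ^+ 2) - c * N (x i - y i) ^+ 2.
  have -> : N (x i + y i) ^+ 2 = 4 * N (mid (x i) (y i)) ^+ 2.
    by rewrite -double_unif_norm_mid; lra.
  have := unif_norm_mid (x i) (y i); have := unif_norm_sqrB (x i) (y i).
  have := sqr_ge0 (N (x i)); have := sqr_ge0 (N (y i)).
  have := sqr_ge0 (N (x i - y i)).
  have := cN (x i) (y i).
  move: (N _ ^+ 2) (N _ ^+ 2) (N _ ^+ 2) (N _ ^+ 2) => a b d f.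
  case: leP => [_ /(_ isT)|? _]; nra.
have py i : N (y i) ^+ 2 <= 2 * N (x i) ^+ 2 + 2 * N (x i - y i) ^+ 2.
  have := unif_norm_sqrB (x i) (x i - y i); rewrite opprB addrC subrK; lra.
have := ler_sum (index_enum I) (fun i (_ : true) => pw i).
have := ler_sum (index_enum I) (fun i (_ : true) => py i).
rewrite !(sumrB, big_split)/= -!mulr_sumr !big_split/=.
set X := \sum_i N (x i) ^+ 2; set Y := \sum_i N (y i) ^+ 2.
set D := \sum_i N (x i - y i) ^+ 2; set S := \sum_i N (x i + y i) ^+ 2.
nra.
Qed.

End UnifNorm.

Section RandomWalk.
Variables (pi : G -> V -> V) (N : V -> R).
Hypotheses (rep : isometric_rep pi) (uN : unif_norm pi N).

Lemma rep_sum g (I : finType) (f : I -> V) : pi g (\sum_i f i) = \sum_i pi g (f i).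
Proof. by apply: big_morph; [exact: repD|exact: rep0]. Qed.

Lemma repMn g x n : pi g (x *+ n) = pi g x *+ n.
Proof. by elim: n => [|n IH]; rewrite ?mulr0n ?(rep0 rep)// !mulrS (repD rep) IH. Qed.

(* [S i] is the position after [2 ^ m] steps of a random walk on [G] and
   [Phi i] the value of a [V]-valued martingale driven by the walk; both walks
   of length [2 ^ m.+1] and their martingales split into two halves. *)
Definition walk_martingale (v xb : V) (C rho : R) (m : nat) : Prop :=
  exists (I : finType) (S : I -> G) (Phi : I -> V),
    [/\ (0 < #|I|)%N, \sum_i Phi i = 0,
      \sum_i N (Phi i) ^+ 2 <= (4 * rho) ^+ m * C * #|I|%:R
    & \sum_i pi (S i) (Phi i) + \sum_i pi (S i) xb = (v *+ (2 ^ m) + xb) *+ #|I| ].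

(** Two independent copies are concatenated, the second martingale being pulled back by the position
    reached in the first half. Its conditional mean is zero, so Jensen's inequality provides [mart],
    the hypothesis of [growth]. The mean of the squares grows by a factor of at most [4 * rho]. *)
Lemma walk_martingaleS v xb C rho m :
  (forall g, pi g v = v) ->
  (forall (I : finType) (x y : I -> V),
    \sum_i N (x i) ^+ 2 <= \sum_i N (x i - y i) ^+ 2 ->
    \sum_i N (x i + y i) ^+ 2 <=
      2 * rho * (\sum_i N (x i) ^+ 2 + \sum_i N (y i) ^+ 2)) ->
  0 <= rho ->
  walk_martingale v xb C rho m -> walk_martingale v xb C rho m.+1.
Proof.
move=> vfix growth rho0 [I [S [Phi [I0 Phi0 PhiN PhiS]]]].
have pairE (W : nmodType) (F : I -> I -> W) :
  \sum_(p : I * I) F p.1 p.2 = \sum_i \sum_j F i j by rewrite pair_bigA.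
pose x (p : I * I) := Phi p.1; pose y (p : I * I) := pi (S p.1)^-1%g (Phi p.2).
have xN : \sum_p N (x p) ^+ 2 = (\sum_i N (Phi i) ^+ 2) * #|I|%:R.
  rewrite (pairE _ (fun i j => N (Phi i) ^+ 2)) mulr_suml.
  by apply: eq_bigr => i _; rewrite sumr_const mulr_natr.
have yN : \sum_p N (y p) ^+ 2 = (\sum_i N (Phi i) ^+ 2) * #|I|%:R.
  rewrite (pairE _ (fun i j => N (pi (S i)^-1%g (Phi j)) ^+ 2)) exchange_big mulr_suml.
  apply: eq_bigr => i _; rewrite mulr_natr -sumr_const.
  by under eq_bigr do rewrite (unif_norm_inv uN).
have xy0 i : \sum_j (Phi i - pi (S i)^-1%g (Phi j)) = Phi i *+ #|I|.
  by rewrite sumrB -rep_sum Phi0 (rep0 rep) subr0 sumr_const.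
have mart : \sum_p N (x p) ^+ 2 <= \sum_p N (x p - y p) ^+ 2.
  rewrite xN (pairE _ (fun i j => N (Phi i - pi (S i)^-1%g (Phi j)) ^+ 2)) mulr_suml.
  apply: ler_sum => i _; set t := N (Phi i).
  have : t * #|I|%:R <= \sum_j N (Phi i - pi (S i)^-1%g (Phi j)).
    by rewrite (le_trans _ (unif_norm_sum uN _))// xy0 (unif_normMn uN) mulrC.
  (* Jensen's inequality for the square, through its tangent at [t]. *)
  have : \sum_j (2 * t * N (Phi i - pi (S i)^-1%g (Phi j)) - t ^+ 2) <=
      \sum_j N (Phi i - pi (S i)^-1%g (Phi j)) ^+ 2.
    apply: ler_sum => j _.
    have := sqr_ge0 (N (Phi i - pi (S i)^-1%g (Phi j)) - t); lra.
  rewrite sumrB -mulr_sumr sumr_const -[t ^+ 2 *+ _]mulr_natr.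
  have : 0 <= t by exact: unif_norm_ge0 uN _.
  nra.
exists (I * I)%type, (fun p => S p.2 * S p.1)%g, (fun p => x p + y p); split.
- by rewrite card_prod muln_gt0 I0.
- rewrite (pairE _ (fun i j => Phi i + pi (S i)^-1%g (Phi j))).
  rewrite (eq_bigr (fun i => Phi i *+ #|I|)) ?sumrMnl ?Phi0 ?mul0rn// => i _.
  by rewrite big_split/= -rep_sum Phi0 (rep0 rep) addr0 sumr_const.
- rewrite (le_trans (growth _ _ _ mart))// xN yN card_prod natrM exprS.
  have n0 : 0 <= #|I|%:R :> R by [].
  have /(ler_wpM2l rho0) {}PhiN := ler_wpM2r n0 PhiN.
  lra.
- rewrite -big_split (pairE _ (fun i j =>
    pi (S j * S i)%g (Phi i + pi (S i)^-1%g (Phi j)) + pi (S j * S i)%g xb)).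
  rewrite exchange_big/=.
  rewrite (eq_bigr (fun j => (v *+ (2 ^ m) + pi (S j) xb + pi (S j) (Phi j)) *+ #|I|)).
    rewrite sumrMnl !big_split/= sumr_const -addrA [X in _ + X]addrC PhiS.
    by rewrite -mulrnDl addrA -mulrnDr addnn -mul2n -expnS -mulrnA card_prod.
  move=> j _.
  rewrite (eq_bigr (fun i =>
    pi (S j) (pi (S i) (Phi i) + pi (S i) xb) + pi (S j) (Phi j))).
    rewrite big_split/= -rep_sum big_split/= PhiS sumr_const repMn (repD rep) repMn vfix.
    by rewrite !mulrnDl.
  move=> i _; rewrite (repD rep) [in LHS](repM rep).
  rewrite [X in _ + X + _](repM rep) (repVK rep).
  by rewrite (repM rep _ _ xb) (repD rep) addrAC.
Qed.

(* If [v] is fixed and a sum of vectors [pi (g i) (x i) - x i], then along the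
   walk the martingale drifts away from [0] linearly in time, with speed
   proportional to the norm of [v], whereas uniform convexity makes it grow
   sublinearly. *)
Lemma drift0 (I : finType) (g : I -> G) (x : I -> V) v :
  (forall h, pi h v = v) -> v = \sum_i (pi (g i) (x i) - x i) -> v = 0.
Proof.
move=> vfix vE; have [I0|I0] := posnP #|I|.
  by rewrite vE big1// => i; have := fintype0 i I0.
have nV : #|I|%:R != 0 :> R by rewrite pnatr_eq0 -lt0n.
pose w := #|I|%:R^-1 *: v; pose xb := #|I|%:R^-1 *: \sum_i x i.
have wn : w *+ #|I| = v by rewrite -scaler_nat scalerA divff// scale1r.
have xbn : xb *+ #|I| = \sum_i x i by rewrite -scaler_nat scalerA divff// scale1r.
have wfix h : pi h w = w.
  by apply: (scalerI nV); rewrite !scaler_nat -repMn wn.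
have [rho /andP[rho0 rho1] growth] := unif_norm_sum_growth uN.
pose C := \sum_i N (x i - xb) ^+ 2.
have C0 : 0 <= C by apply: sumr_ge0 => i _; exact: sqr_ge0.
have walk m : walk_martingale w xb C rho m.
  elim: m => [|m]; last exact: walk_martingaleS (ltW rho0).
  exists I, g, (fun i => x i - xb); split => //.
  - by rewrite sumrB sumr_const xbn subrr.
  - by rewrite expr0 mul1r ler_peMr// ler1n.
  - rewrite -big_split/=; under eq_bigr do rewrite -(repD rep) subrK.
    by rewrite expn0 mulr1n mulrnDl wn xbn vE sumrB subrK.
have [k k0 kN] := unif_norm_ge uN.
(* [sigma] is at least the square root of [rho], so [(4 * rho) ^+ m] is at most the square of
   [(2 * sigma) ^+ m]. *)
pose sigma := (1 + rho) / 2.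
have [sigma0 sigma1] : 1 / 2 <= sigma /\ sigma < 1 by rewrite /sigma; split; lra.
pose D := k * ((C + 1) / 2) + 2 * `|xb|.
have D0 : 0 <= D by rewrite addr_ge0// mulr_ge0// ?divr_ge0 ?addr_ge0// ltW.
have bound m : `|w| <= D * sigma ^+ m.
  have [J [S [Phi [J0 _ PhiN PhiS]]]] := walk m.
  have J0R : 0 < #|J|%:R :> R by rewrite ltr0n.
  pose s := (2 * sigma) ^+ m.
  have s1 : 1 <= s by rewrite exprn_ege1//; lra.
  have ss : (4 * rho) ^+ m <= s ^+ 2.
    rewrite -exprM mulnC exprM lerXn2r ?nnegrE ?sqr_ge0//; first by lra.
    have := sqr_ge0 (1 - rho); rewrite /sigma; nra.
  have NPhi : \sum_i N (Phi i) <= #|J|%:R * (s * ((C + 1) / 2)).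
    have : \sum_i (s * N (Phi i)) <= \sum_i (N (Phi i) ^+ 2 / 2 + s ^+ 2 / 2).
      apply: ler_sum => i _; have := sqr_ge0 (N (Phi i) - s); lra.
    rewrite -mulr_sumr big_split/= -mulr_suml sumr_const -mulr_natr.
    have := ler_wpM2r (mulr_ge0 C0 (ltW J0R)) ss.
    rewrite mulrA => H1 H2; rewrite -(ler_pM2l (lt_le_trans ltr01 s1)); nra.
  have : `|(w *+ (2 ^ m) + xb) *+ #|J| | <= \sum_i `|Phi i| + #|J|%:R * `|xb|.
    rewrite -PhiS (le_trans (ler_normD _ _))// lerD//.
      rewrite (le_trans (ler_norm_sum _ _ _))//.
      by apply: ler_sum => i _; rewrite (rep_norm rep).
    rewrite (le_trans (ler_norm_sum _ _ _))//; under eq_bigr do rewrite (rep_norm rep).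
    by rewrite sumr_const mulr_natl.
  have : \sum_i `|Phi i| <= k * \sum_i N (Phi i).
    by rewrite mulr_sumr; exact: ler_sum.
  have : 2 ^+ m * `|w| <= `|w *+ (2 ^ m) + xb| + `|xb|.
    have -> : 2 ^+ m * `|w| = `|w *+ (2 ^ m)| by rewrite normrMn -[RHS]mulr_natl natrX.
    by rewrite -{1}(addrK xb (w *+ _)) (le_trans (ler_normB _ _)).
  move=> H1 H2; rewrite normrMn -[_ *+ #|J|]mulr_natl => H3.
  have H4 : `|w *+ (2 ^ m) + xb| <= k * (s * ((C + 1) / 2)) + `|xb|.
    rewrite -(ler_pM2l J0R) (le_trans H3)//.
    have := ler_wpM2l (ltW k0) NPhi; lra.
  have H5 : `|xb| <= s * `|xb| by rewrite ler_peMl.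
  have m0 : 0 < 2 ^+ m :> R by rewrite exprn_gt0.
  rewrite -(ler_pM2l m0) mulrCA -exprMn -/s /D; lra.
apply/eqP; rewrite -wn -scaler_nat scaler_eq0 (negbTE nV)/= -normr_le0.
have : D * sigma ^+ m @[m --> \oo] --> 0.
  by apply: cvg_geometric; rewrite ger0_norm//; lra.
move=> D_cvg; rewrite -(cvg_lim (@Rhausdorff R) D_cvg).
by apply: limr_ge; [apply/cvg_ex; exists 0|exact: nearW].
Qed.
End RandomWalk.
End Drift.

(** * Uniform convexity and invariant renorming *)

Section UniformConvexity.
Context {R : realType} {W : normedModType R}.
Implicit Types (x y : W).

(** For [b <= a] the combination is [a *: (x + y) - (a - b) *: y], and the triangle inequality
    suffices. *)
Lemma norm_comb_ge (d a b : R) x y : 0 <= a -> 0 <= b -> 0 <= d ->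
  `|x| = 1 -> `|y| = 1 -> 2 - 2 * d <= `|x + y| ->
  (a + b) * (1 - 2 * d) <= `|a *: x + b *: y|.
Proof.
wlog ba : a b x y / b <= a => [H|].
  have [ba|/ltW ab] := leP b a; first exact: H.
  move=> a0 b0 d0 x1 y1 xy; rewrite (addrC a) (addrC (a *: x)).
  by apply: H => //; rewrite (addrC y).
move=> a0 b0 d0 x1 y1 xy.
have -> : a *: x + b *: y = a *: (x + y) - (a - b) *: y.
  by rewrite scalerDr scalerBl opprB -addrA [X in _ = _ + X]addrC subrK.
have := lerB_dist (a *: (x + y)) ((a - b) *: y).
rewrite !normrZ y1 mulr1 ger0_norm// ger0_norm ?subr_ge0//.
nra.
Qed.

Lemma normalized_segment_cvg x y (s : R) :
  (forall t, 0 <= t <= 1 -> (1 - t) *: x + t *: y != 0) -> 0 <= s <= 1 ->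
  {for s, continuous (fun t : R =>
    `|x - `|(1 - t) *: x + t *: y|^-1 *: ((1 - t) *: x + t *: y)| : R)}.
Proof.
move=> seg s01; pose g t := (1 - t) *: x + t *: y.
have g_cvg : g t @[t --> s] --> g s.
  apply: cvgD; apply: cvgZr_tmp; last exact: cvg_id.
  by apply: cvgB; [exact: cvg_cst|exact: cvg_id].
apply: cvg_norm; apply: cvgB; first exact: cvg_cst.
apply: cvgZ => //; apply: cvgV; first by rewrite normr_eq0 seg.
exact: cvg_norm.
Qed.

Hypothesis W_uc : uniformly_convex W.

(* In [uniformly_convex] the modulus is an arbitrary positive function, with no
   monotonicity: a pair at distance at least [e] is compared with a pair of unit
   vectors at distance exactly [e], found on the arc between the two points. *)
Lemma uniformly_convex_modulus (e : R) : 0 < e ->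
  exists2 d : R, 0 < d & forall x y, `|x| = 1 -> `|y| = 1 -> e <= `|x - y| ->
    `|x + y| <= 2 - 2 * d.
Proof.
have [delta [delta0 deltaP]] := W_uc.
move=> e0; have [e2|e2] := leP e 2; last first.
  exists 1 => // x y x1 y1 exy.
  by have := ler_normB x y; rewrite x1 y1; lra.
have de0 : 0 < delta e by rewrite delta0// e0.
(* [4^-1] keeps the segment from [x] to [y] at distance at least [1 / 2] from [0]; [delta e / 3]
   ensures [2 * d < delta e], which gives the final contradiction. *)
pose d := Num.min 4^-1 (delta e / 3).
have d0 : 0 < d by rewrite lt_min invr_gt0 ltr0n divr_gt0.
have d4 : d <= 4^-1 by rewrite ge_min lexx.
have d3 : d <= delta e / 3 by rewrite ge_min lexx orbT.
exists d => // x y x1 y1 exy; rewrite leNgt; apply/negP => /ltW xy.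
have seg_ge t : 0 <= t <= 1 -> 1 / 2 <= `|(1 - t) *: x + t *: y|.
  move=> /andP[t0 t1].
  have := @norm_comb_ge d (1 - t) t x y; rewrite subr_ge0 subrK => H.
  by have := H t1 t0 (ltW d0) x1 y1 xy; lra.
have seg t : 0 <= t <= 1 -> (1 - t) *: x + t *: y != 0.
  by move=> /seg_ge; rewrite -normr_gt0; lra.
have seg_le t : 0 <= t <= 1 -> `|(1 - t) *: x + t *: y| <= 1.
  move=> /andP[t0 t1]; rewrite (le_trans (ler_normD _ _))// !normrZ x1 y1.
  by rewrite !ger0_norm ?subr_ge0//; lra.
pose f t := `|x - `|(1 - t) *: x + t *: y|^-1 *: ((1 - t) *: x + t *: y)|.
have [||t t01 ft] := @IVT R f 0 1 e ler01.
- apply: continuous_in_subspaceT => t; rewrite inE/= in_itv/= => t01.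
  exact: normalized_segment_cvg.
- rewrite /f subr0 scale1r scale0r addr0 x1 invr1 scale1r subrr normr0.
  rewrite subrr scale0r add0r scale1r y1 invr1 scale1r.
  by rewrite ge_min (ltW e0) le_max exy orbT.
rewrite in_itv/= in t01; have /andP[t0 t1] := t01.
move: ft; rewrite /f; set r := `|(1 - t) *: x + t *: y|; set z := r^-1 *: _ => xz.
have r0 : 0 < r by have := seg_ge _ t01; rewrite -/r; lra.
have r1 : r <= 1 by exact: seg_le.
have z1 : `|z| = 1 by rewrite normrZ normfV normr_id mulVf// gt_eqF.
have := deltaP x z; rewrite xz => /(_ _ x1 z1) H.
have {H} : 1 - `|x + z| / 2 >= delta e.
  by apply: H; apply/eqP => xze; move: xz; rewrite xze subrr normr0; lra.
have -> : x + z = (1 + r^-1 * (1 - t)) *: x + (r^-1 * t) *: y.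
  by rewrite /z scalerDr !scalerA scalerDl scale1r addrA.
have ri : 1 <= r^-1 by rewrite invf_ge1.
have := @norm_comb_ge d (1 + r^-1 * (1 - t)) (r^-1 * t) x y.
have -> : 1 + r^-1 * (1 - t) + r^-1 * t = 1 + r^-1 by lra.
have a0 : 0 <= r^-1 * (1 - t) by rewrite mulr_ge0 ?subr_ge0// (le_trans ler01).
have b0 : 0 <= r^-1 * t by rewrite mulr_ge0// (le_trans ler01).
move=> /(_ (addr_ge0 ler01 a0) b0 (ltW d0) x1 y1 xy).
move: ri; set i := r^-1; move: `|_ + _| => n ri.
have : 0 <= (i - 1) * (1 - 2 * d) by rewrite mulr_ge0//; lra.
lra.
Qed.

(** Let [x] be the longer vector. Either the lengths differ by a fixed proportion, and strict
    convexity of the square gives the gain [e ^+ 2 / 64]; or the normalized vectors are at distance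
    at least [e / 2], and the modulus gives [d / 4]. *)
Lemma uniformly_convex_sqr (eta : R) : 0 < eta ->
  exists2 c : R, 0 < c <= 1 & forall x y,
    eta * (`|x| ^+ 2 + `|y| ^+ 2) <= `|x - y| ^+ 2 ->
    `|mid x y| ^+ 2 <= (1 - c) * ((`|x| ^+ 2 + `|y| ^+ 2) / 2).
Proof.
move=> eta0; pose e := Num.min 1 eta.
have e0 : 0 < e by rewrite lt_min ltr01.
have e1 : e <= 1 by rewrite ge_min lexx.
have ee : e ^+ 2 <= eta.
  have : e <= eta by rewrite ge_min lexx orbT.
  nra.
have [d' d'0 dP'] := @uniformly_convex_modulus (e / 2) (divr_gt0 e0 (ltr0Sn _ _)).
pose d := Num.min 1 d'.
have d0 : 0 < d by rewrite lt_min ltr01.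
have d1 : d <= 1 by rewrite ge_min lexx.
have dP x y : `|x| = 1 -> `|y| = 1 -> e / 2 <= `|x - y| -> `|x + y| <= 2 - 2 * d.
  move=> x1 y1 /(dP' _ _ x1 y1) /le_trans; apply.
  have : d <= d' by rewrite ge_min lexx orbT.
  lra.
exists (Num.min (e ^+ 2 / 64) (d / 4)) => [|x y].
  rewrite lt_min ge_min !divr_gt0 ?exprn_gt0//=.
  by apply/orP; right; lra.
have c1 : Num.min (e ^+ 2 / 64) (d / 4) <= e ^+ 2 / 64 by rewrite ge_min lexx.
have c2 : Num.min (e ^+ 2 / 64) (d / 4) <= d / 4 by rewrite ge_min lexx orbT.
move: (Num.min _ _) c1 c2 => c c1 c2.
wlog ba : x y / `|y| <= `|x| => [H xy|].
  have [yx|/ltW yx] := leP `|y| `|x|; first exact: H.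
  by rewrite midC [X in X / 2]addrC; apply: H => //; rewrite addrC distrC.
have [/eqP|a0] := eqVneq `|x| 0.
  rewrite normr_eq0 => /eqP x0 _; move: ba; rewrite x0 normr0 normr_le0 => /eqP ->.
  by rewrite mid_self !normr0 expr0n/= addr0 mul0r mulr0.
have {}a0 : 0 < `|x| by rewrite lt_neqAle eq_sym a0/=.
move=> xy.
have exy : e * `|x| <= `|x - y|.
  rewrite -(ler_pXn2r (n := 2)) ?nnegrE ?mulr_ge0 ?(ltW e0)// (le_trans _ xy)//.
  rewrite exprMn; have := sqr_ge0 `|y|; have := sqr_ge0 `|x|; nra.
have nm : `|mid x y| = `|x + y| / 2.
  by rewrite normrZ ger0_norm ?invr_ge0// mulrC.
have b0 := normr_ge0 y; have m0 := normr_ge0 (mid x y).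
have [far|nr] := leP (e / 4 * `|x|) (`|x| - `|y|).
  have : `|mid x y| <= (`|x| + `|y|) / 2.
    by rewrite nm ler_pM2r ?invr_gt0// ler_normD.
  move: far ba a0 b0 m0 {nm exy xy}; move: `|x| `|y| `|mid x y| => a b m.
  move=> far ba a0 b0 m0 H.
  have : m ^+ 2 <= ((a + b) / 2) ^+ 2.
    by rewrite lerXn2r ?nnegrE// divr_ge0// addr_ge0// ltW.
  have : (e / 4 * a) ^+ 2 <= (a - b) ^+ 2.
    by rewrite lerXn2r ?nnegrE// ?subr_ge0// mulr_ge0 ?(ltW a0)// divr_ge0// ltW.
  have : c * ((a ^+ 2 + b ^+ 2) / 2) <= e ^+ 2 / 64 * a ^+ 2.
    have ab2 : (a ^+ 2 + b ^+ 2) / 2 <= a ^+ 2 by nra.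
    have ab0 : 0 <= (a ^+ 2 + b ^+ 2) / 2 by have := sqr_ge0 a; have := sqr_ge0 b; lra.
    by rewrite (le_trans (ler_wpM2r ab0 c1))// ler_wpM2l// divr_ge0 ?sqr_ge0.
  lra.
have bb : `|x| / 2 <= `|y|.
  have : e * `|x| <= `|x| by rewrite ler_piMl.
  lra.
have y0 : 0 < `|y| by lra.
pose x' := `|x|^-1 *: x; pose y' := `|y|^-1 *: y.
have x'1 : `|x'| = 1 by rewrite normrZ normfV normr_id mulVf// gt_eqF.
have y'1 : `|y'| = 1 by rewrite normrZ normfV normr_id mulVf// gt_eqF.
have xx' : x = `|x| *: x' by rewrite scalerA divff ?scale1r// gt_eqF.
have yy' : y = `|y| *: y' by rewrite scalerA divff ?scale1r// gt_eqF.
clearbody x' y'.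
have /(dP _ _ x'1 y'1) x'y' : e / 2 <= `|x' - y'|.
  rewrite -(ler_pM2l a0) -{2}(ger0_norm (ltW a0)) -normrZ scalerBr -xx'.
  have -> : x - `|x| *: y' = (x - y) - (`|x| - `|y|) *: y'.
    by rewrite scalerBl -yy' opprB addrA subrK.
  have := lerB_dist (x - y) ((`|x| - `|y|) *: y').
  rewrite normrZ y'1 mulr1 ger0_norm ?subr_ge0//; lra.
have : `|x + y| <= `|y| * (2 - 2 * d) + (`|x| - `|y|).
  have -> : x + y = `|y| *: (x' + y') + (`|x| - `|y|) *: x'.
    by rewrite scalerDr -yy' scalerBl -xx' [RHS]addrC addrA subrK.
  rewrite (le_trans (ler_normD _ _))// !normrZ x'1 mulr1 normr_id.
  by rewrite (ger0_norm (x := _ - _)) ?subr_ge0// lerD// ler_wpM2l.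
have {}nm : `|x + y| = 2 * `|mid x y| by rewrite nm; lra.
rewrite nm.
move: bb ba a0 b0 m0 {nr y0 nm exy xy xx' yy'}; move: `|x| `|y| `|mid x y| => a b m.
move=> bb ba a0 b0 m0 H.
have H1 : m <= (a + b) / 2 - a * d / 2 by nra.
have H2 : m ^+ 2 <= ((a + b) / 2 - a * d / 2) ^+ 2.
  by rewrite lerXn2r ?nnegrE// (le_trans m0).
have H3 : c * ((a ^+ 2 + b ^+ 2) / 2) <= d / 4 * a ^+ 2.
  have ab2 : (a ^+ 2 + b ^+ 2) / 2 <= a ^+ 2 by nra.
  have ab0 : 0 <= (a ^+ 2 + b ^+ 2) / 2 by have := sqr_ge0 a; have := sqr_ge0 b; lra.
  rewrite (le_trans (ler_wpM2r ab0 c2))// ler_wpM2l// divr_ge0//; lra.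
have H4 : ((a + b) / 2 - a * d / 2) ^+ 2 <= ((a + b) / 2) ^+ 2 - a ^+ 2 * d / 4.
  have : 0 <= a * d * (b - a * d / 2) by rewrite !mulr_ge0 ?(ltW a0) ?(ltW d0)//; nra.
  have : 0 <= a ^+ 2 * d by rewrite mulr_ge0 ?sqr_ge0 ?(ltW d0).
  lra.
have := sqr_ge0 (a - b); lra.
Qed.

End UniformConvexity.

Section Renorming.
Context {R : realType} {V : completeNormedModType R} {G : groupType}.

Lemma linear_continuous_bound (V1 V2 : normedModType R) (T : {linear V1 -> V2}) :
  continuous T -> exists2 K, 0 < K & forall x, `|T x| <= K * `|x|.
Proof.
move=> /linear_bounded_continuous/linear_boundedP [M [_ MP]].
exists (Num.max M 0 + 1); first by rewrite ltr_wpDl// le_max lexx orbT.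
by apply: MP; rewrite ltr_pwDr// le_max lexx.
Qed.

(** [N] is the supremum over the orbit of the norm pulled back from the uniformly convex space [W].
    Convexity survives the supremum because one [c] works for all [g]. *)
Lemma superreflexive_unif_norm (pi : G -> V -> V) : isometric_rep pi ->
  superreflexive V -> exists N : V -> R, unif_norm pi N.
Proof.
move=> rep [W [T [S [TS _ T_cont S_cont W_uc]]]].
have [K K0 TK] := linear_continuous_bound T_cont.
have [L L0 SL] := linear_continuous_bound S_cont.
pose A x := [set `|T (pi g x)| | g in [set: G]].
pose N x := sup (A x).
have A_le x g : `|T (pi g x)| <= K * `|x| by rewrite -(rep_norm rep g x).
have A_ub x : has_ubound (A x) by exists (K * `|x|) => _ [g _ <-].
have A0 x : A x !=set0 by exists `|T (pi 1%g x)|, 1%g.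
have N_ge x g : `|T (pi g x)| <= N x by apply: ub_le_sup => //; exists g.
have N_le x c : (forall g, `|T (pi g x)| <= c) -> N x <= c.
  by move=> xc; apply: ge_sup => // _ [g _ <-].
have LN x : `|x| <= L * N x.
  have := SL (T (pi 1%g x)); rewrite TS (rep1 rep) => /le_trans; apply.
  by rewrite ler_wpM2l ?(ltW L0)// -{1}(rep1 rep x).
have NK x : N x <= K * `|x| by exact: N_le.
have N0 x : 0 <= N x by rewrite (le_trans _ (N_ge x 1%g)).
exists N; split.
- move=> g x; congr sup; apply/seteqP; split=> _ [h _ <-].
    by exists (h * g)%g => //; rewrite (repM rep).
  by exists (h * g^-1)%g => //; rewrite -(repM rep) mulgVK.
- move=> x y; apply: N_le => g.
  by rewrite (repD rep) linearD (le_trans (ler_normD _ _))// lerD.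
- move=> x; congr sup; apply/seteqP; split=> _ [h _ <-]; exists h => //.
    by rewrite (repN rep) linearN normrN.
  by rewrite (repN rep) linearN normrN.
- move=> x n; apply/eqP; rewrite eq_le; apply/andP; split.
    apply: N_le => g; rewrite (repMn rep) linearMn normrMn -[leLHS]mulr_natl.
    by rewrite ler_wpM2l.
  case: n => [|n]; first by rewrite mul0r.
  rewrite mulrC -ler_pdivlMr//; apply: N_le => g; rewrite ler_pdivlMr//.
  by rewrite mulr_natr -normrMn -linearMn -(repMn rep).
- by exists L.
- by exists K.
move=> eta eta0.
(* For each [g], [N z] is at most [L * K] times the norm of [T (pi g z)], so vectors far apart for
   [N] have images far apart in [W] for every [g]. *)
have [|c /andP[c0 c1] cW] := @uniformly_convex_sqr _ _ W_uc (eta / (L * K) ^+ 2).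
  by rewrite divr_gt0// exprn_gt0// mulr_gt0.
exists c => [|x y xyN]; first by rewrite c0.
have mid_le g : `|T (pi g (mid x y))| ^+ 2 <= (1 - c) * ((N x ^+ 2 + N y ^+ 2) / 2).
  have -> : T (pi g (mid x y)) = mid (T (pi g x)) (T (pi g y)).
    by rewrite (rep_mid rep) linearZ linearD.
  have sq z : `|T (pi g z)| ^+ 2 <= N z ^+ 2 by rewrite lerXn2r ?nnegrE.
  rewrite (le_trans (cW _ _ _))//.
    rewrite mulrAC ler_pdivrMr ?exprn_gt0 ?mulr_gt0//.
    rewrite (le_trans (ler_wpM2l (ltW eta0) (lerD (sq x) (sq y))))// (le_trans xyN)//.
    rewrite -exprMn lerXn2r ?nnegrE ?mulr_ge0 ?(ltW L0) ?(ltW K0)//.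
    rewrite -linearB -(repB rep).
    have := SL (T (pi g (x - y))); rewrite TS (rep_norm rep) => /(ler_wpM2l (ltW K0)).
    have := NK (x - y); lra.
  rewrite ler_wpM2l ?subr_ge0// ler_wpM2r ?invr_ge0// lerD//.
have B0 : 0 <= (1 - c) * ((N x ^+ 2 + N y ^+ 2) / 2).
  exact: le_trans (sqr_ge0 _) (mid_le 1%g).
rewrite -[leRHS]sqr_sqrtr// lerXn2r ?nnegrE ?sqrtr_ge0//.
by apply: N_le => g; rewrite -(ler_pXn2r (n := 2)) ?nnegrE ?sqrtr_ge0// sqr_sqrtr.
Qed.

End Renorming.

(** * Limit cocycles *)

Section Frames.
Context {R : realType} {V : completeNormedModType R} {G : groupType}.
Implicit Types (alpha : G -> V -> V) (c : G -> V) (g h k : G) (x y : V).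

(* The cocycles [g |-> alpha g x - x] of the points [x], and their pointwise
   limits, which play the role of the points of an ultrapower of [V]. *)
Definition limit_cocycle alpha c : Prop :=
  forall (F : seq G) (e : R), 0 < e ->
    exists x, forall g, g \in F -> `|c g - (alpha g x - x)| <= e.

Lemma small_eq0 x : (forall e, 0 < e -> `|x| <= e) -> x = 0.
Proof.
move=> xe; apply/eqP; rewrite -normr_le0 leNgt; apply/negP => x0.
by have := xe (`|x| / 2); rewrite divr_gt0// => /(_ isT); lra.
Qed.

Section Cocycles.
Variables (alpha : G -> V -> V) (act : isometric_action alpha).
Local Notation pi := (linear_part alpha).
Let rep : isometric_rep pi := linear_part_rep act.

Lemma limit_cocycle_orbit x : limit_cocycle alpha (fun g => alpha g x - x).
Proof. by move=> F e e0; exists x => g _; rewrite subrr normr0 ltW. Qed.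

Lemma limit_cocycleM c g h : limit_cocycle alpha c ->
  c (g * h)%g = c g + pi g (c h).
Proof.
move=> cl; apply/eqP; rewrite -subr_eq0; apply/eqP; apply: small_eq0 => e e0.
have [|x xP] := cl [:: g; h; (g * h)%g] (e / 3); first by rewrite divr_gt0.
have hM : alpha (g * h)%g x - x = (alpha g x - x) + pi g (alpha h x - x).
  by case: act => _ -> _; rewrite -(actB act) [RHS]addrC addrA subrK.
have -> : c (g * h)%g - (c g + pi g (c h)) =
    (c (g * h)%g - (alpha (g * h)%g x - x)) - (c g - (alpha g x - x))
    - pi g (c h - (alpha h x - x)).
  have E (a b d s t : V) : a - (b + d) = (a - (s + t)) - (b - s) - (d - t).
    by rewrite -[RHS]addrA -opprD [b - s + _]addrACA -opprD opprB addrA subrK.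
  by rewrite [pi g (c h - _)](repB rep) hM -E.
have ce k : k \in [:: g; h; (g * h)%g] -> `|c k - (alpha k x - x)| <= e / 3 := xP k.
rewrite (le_trans (ler_normB _ _))// -[e](@divfK _ 3)// mulr_natr 2!mulrSr mulr1n.
rewrite lerD// ?(rep_norm rep) ?ce ?inE ?eqxx ?orbT//.
by rewrite (le_trans (ler_normB _ _))// lerD ?ce ?inE ?eqxx ?orbT.
Qed.

Lemma limit_cocycle1 c : limit_cocycle alpha c -> c 1%g = 0.
Proof.
move=> cl; have := limit_cocycleM 1%g 1%g cl; rewrite mulg1 (rep1 rep).
by move/eqP; rewrite -subr_eq subrr eq_sym => /eqP.
Qed.

Lemma limit_cocycleV c g : limit_cocycle alpha c -> c g^-1%g = - pi g^-1%g (c g).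
Proof.
move=> cl; apply/eqP; rewrite -addr_eq0; apply/eqP.
by rewrite -(limit_cocycleM _ _ cl) mulVg (limit_cocycle1 cl).
Qed.

Lemma limit_cocycle_ker c : limit_cocycle alpha c -> is_subgroup [set g | c g = 0].
Proof.
move=> cl; split=> [|g h /= g0 h0]; first exact: limit_cocycle1.
rewrite (limit_cocycleM _ _ cl) (limit_cocycleV _ cl) g0 h0.
by rewrite !(rep0 rep) oppr0 (rep0 rep) addr0.
Qed.

Lemma limit_cocycle_lim (c_ : nat -> G -> V) c : (forall n, limit_cocycle alpha (c_ n)) ->
  (forall g, c_ n g @[n --> \oo] --> c g) -> limit_cocycle alpha c.
Proof.
move=> cl ccvg F e e0; have e2 : 0 < e / 2 by rewrite divr_gt0.
have [n cn] : exists n, forall g, g \in F -> `|c g - c_ n g| <= e / 2.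
  have : \forall n \near \oo, forall g, g \in F -> `|c g - c_ n g| <= e / 2.
    elim: F => [|g F IH]; first exact: nearW.
    have /cvgrPdist_le/(_ _ e2) Hg := ccvg g.
    near=> n => h; rewrite inE => /predU1P[->|hF].
      by near: n.
    by move: h hF; near: n.
  by move=> /filter_ex [n nP]; exists n.
have [x xP] := cl n F (e / 2) e2; exists x => g gF.
rewrite (le_trans (ler_distD (c_ n g) _ _))// [e]splitr lerD ?cn//; exact: xP.
Unshelve. all: by end_near. Qed.

Lemma limit_cocycle_mid c c' : limit_cocycle alpha c -> limit_cocycle alpha c' ->
  limit_cocycle alpha (fun g => mid (c g) (c' g)).
Proof.
move=> cl c'l F e e0.
have [[x xP] [y yP]] := (cl F e e0, c'l F e e0).
exists (mid x y) => g gF; rewrite (act_mid act) !midB.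
rewrite normrZ ger0_norm ?invr_ge0// ler_pdivrMl//.
rewrite (le_trans (ler_normD _ _))// mulr_natl mulr2n lerD ?xP ?yP//.
Qed.

(** This is the generalized point of [c] moved by [alpha g^-1%g], seen by the action twisted by
    [phi]. *)
Lemma limit_cocycle_transport (phi : G -> G) g c : limit_cocycle alpha c ->
  limit_cocycle (fun k => alpha (phi k)) (fun k => pi g^-1%g (c (conj_by g (phi k)))).
Proof.
move=> cl F e e0.
have [x xP] := cl [seq conj_by g (phi k) | k <- F] e e0.
exists (alpha g^-1%g x) => k kF.
have -> : alpha (phi k) (alpha g^-1%g x) - alpha g^-1%g x =
    pi g^-1%g (alpha (conj_by g (phi k)) x - x).
  rewrite -(actB act) /conj_by; case: act => _ aM _.
  by rewrite -!aM !mulgA mulVg mul1g.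
by rewrite -(repB rep) (rep_norm rep) xP//; apply/mapP; exists k.
Qed.

Definition coboundary_sum x : Prop :=
  exists s : seq (G * V), x = \sum_(p <- s) (pi p.1 p.2 - p.2).

Lemma coboundary_sum1 g x : coboundary_sum (pi g x - x).
Proof. by exists [:: (g, x)]; rewrite big_seq1. Qed.

Lemma coboundary_sumD x y :
  coboundary_sum x -> coboundary_sum y -> coboundary_sum (x + y).
Proof. by move=> [s ->] [t ->]; exists (s ++ t); rewrite big_cat. Qed.

Lemma coboundary_sumN x : coboundary_sum x -> coboundary_sum (- x).
Proof.
move=> [s ->]; exists [seq (p.1, - p.2) | p <- s].
rewrite big_map -sumrN; apply: eq_bigr => p _ /=.
by rewrite (repN rep) opprB opprK addrC.
Qed.

Lemma coboundary_sum_rep g x : coboundary_sum x -> coboundary_sum (pi g x).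
Proof.
move=> cx; rewrite -(subrK x (pi g x)).
by apply: coboundary_sumD => //; exact: coboundary_sum1.
Qed.

Lemma coboundary_sum_subgroup c : limit_cocycle alpha c ->
  is_subgroup [set g | coboundary_sum (c g)].
Proof.
move=> cl; split=> [|g h /= cg ch].
  by exists [::]; rewrite (limit_cocycle1 cl) big_nil.
rewrite (limit_cocycleM _ _ cl) (limit_cocycleV _ cl).
apply: coboundary_sumD => //; apply: coboundary_sum_rep.
by apply: coboundary_sumN; exact: coboundary_sum_rep.
Qed.

Lemma coboundary_sum_fixed (N : V -> R) v : unif_norm pi N ->
  coboundary_sum v -> (forall h, pi h v = v) -> v = 0.
Proof.
move=> uN [s sv] vfix.
apply: (@drift0 _ _ _ _ _ rep uN 'I_(size s)
  (fun i => (tnth (in_tuple s) i).1) (fun i => (tnth (in_tuple s) i).2)) => //.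
by rewrite sv big_tnth.
Qed.

End Cocycles.
End Frames.

(** * Minimizing families and the game *)

Section Game.
Context {R : realType} {V : completeNormedModType R} {G : groupType} {l : nat}.
Implicit Types (alpha : G -> V -> V) (M H : 'I_l -> set G) (N : V -> R).
Implicit Types (c : 'I_l -> G -> V) (u : 'I_l * 'I_l -> V).

(* A family of generalized points, the [i]-th one being fixed by [M i] and
   known through its cocycle [c i], with their mutual differences [u]. *)
Definition frame alpha M c u : Prop :=
  [/\ forall i, limit_cocycle alpha (c i),
      forall i m, M i m -> c i m = 0
    & forall i j g, c i g - c j g = linear_part alpha g (u (i, j)) - u (i, j)].

Definition energy N u : R := \sum_p N (u p) ^+ 2.

Definition frame_min N alpha M c u : Prop :=
  frame alpha M c u /\
  forall c' u', frame alpha M c' u' -> energy N u <= energy N u'.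

Section OneAction.
Variables (alpha : G -> V -> V) (act : isometric_action alpha).
Variables (N : V -> R) (uN : unif_norm (linear_part alpha) N).
Variables (M : 'I_l -> set G) (M_gen : gen_subgroup (\bigcup_i M i) = [set: G]).
Local Notation pi := (linear_part alpha).
Let rep : isometric_rep pi := linear_part_rep act.
Let gN : gauge (fun x => N x ^+ 2) := unif_norm_gauge uN.

Lemma is_subgroup_forall (I : Type) (H : I -> set G) :
  (forall i, is_subgroup (H i)) -> is_subgroup [set g | forall i, H i g].
Proof.
move=> Hs; split=> [i|g h gH hH i]; have [H1 HM] := Hs i; first exact: H1.
exact: HM.
Qed.

Definition frame_diffs : set ('I_l * 'I_l -> V) := [set u | exists c, frame alpha M c u].

Lemma frame_diffs_mid u v : frame_diffs u -> frame_diffs v ->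
  frame_diffs (fun p => mid (u p) (v p)).
Proof.
move=> [c [c1 c2 c3]] [d [d1 d2 d3]]; exists (fun i g => mid (c i g) (d i g)); split.
- by move=> i; exact: limit_cocycle_mid.
- by move=> i m Mm; rewrite c2// d2// mid_self.
- by move=> i j g; rewrite midB c3 d3 -midB (rep_mid rep).
Qed.

(** The differences of a minimizing sequence converge. They determine every [c i] on each [M j],
    because [c j] vanishes there; convergence then spreads to [G] by the cocycle identity. The
    limits need not be cocycles of actual points. *)
Lemma frame_min_exists : (forall i, fixed_points alpha (M i) !=set0) ->
  exists c u, frame_min N alpha M c u.
Proof.
move=> /choice[x xM].
have /(min_sequence gN frame_diffs_mid) [m [u_ [z [uK mK _ u_cvg zm]]]] :
    frame_diffs !=set0.
  exists (fun p => x p.1 - x p.2), (fun i g => alpha g (x i) - x i); split.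
  - by move=> i; exact: limit_cocycle_orbit.
  - by move=> i h /xM ->; rewrite subrr.
  - by move=> i j g; rewrite -(actB act) !opprB [LHS]addrACA [RHS]addrACA (addrC (- x i)).
have /choice[c_ cP] := uK.
have cl n i : limit_cocycle alpha (c_ n i) by have [] := cP n.
have c_cvg g : forall i, cvg (c_ n i g @[n --> \oo]).
  apply: (gen_subgroup_full (H := [set g | forall i, cvg (c_ n i g @[n --> \oo])]) M_gen).
    apply: (@is_subgroup_forall _ (fun i => [set g | cvg (c_ n i g @[n --> \oo])])) => i.
    split=> /= [|a b ca cb].
      by under eq_fun do rewrite (limit_cocycle1 act (cl _ i)); exact: is_cvg_cst.
    under eq_fun do
      rewrite (limit_cocycleM act _ _ (cl _ i)) (limit_cocycleV act _ (cl _ i)).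
    apply: is_cvgD => //; apply/cvg_ex; eexists; apply: (rep_cvg rep).
    by apply: cvgN; apply: (rep_cvg rep); exact: cb.
  move=> h [j _ Mh] i; apply/cvg_ex; exists (pi h (z (i, j)) - z (i, j)).
  have -> : (fun n => c_ n i h) = (fun n => pi h (u_ n (i, j)) - u_ n (i, j)).
    by apply/funext => n; have [_ c2 c3] := cP n; rewrite -c3 (c2 j h Mh) subr0.
  by apply: cvgB => //; exact: (rep_cvg rep).
exists (fun i g => lim (c_ n i g @[n --> \oo])), z; split; last first.
  by move=> c' u' fr; rewrite /energy zm; apply: mK; exists c'.
split.
- move=> i; apply: (@limit_cocycle_lim _ _ _ _ (fun n => c_ n i)) => [n|g].
    exact: cl.
  exact: (c_cvg g i).
- move=> i h Mh; have -> : (fun n => c_ n i h) = (fun=> 0).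
    by apply/funext => n; have [_ c2 _] := cP n; exact: c2.
  exact: lim_cst.
- move=> i j g; apply: (@cvg_unique V _ (c_ n i g - c_ n j g @[n --> \oo])) => //.
    by apply: cvgB; exact: c_cvg.
  have -> : (fun n => c_ n i g - c_ n j g) = (fun n => pi g (u_ n (i, j)) - u_ n (i, j)).
    by apply/funext => n; have [_ _ ->] := cP n.
  by apply: cvgB => //; exact: (rep_cvg rep).
Qed.

(** Uniform convexity forces [u = u'], and the differences determine the cocycles on each [M j],
    hence on [G]. *)
Lemma frame_min_unique c u c' u' : frame_min N alpha M c u ->
  frame_min N alpha M c' u' -> forall i g, c i g = c' i g.
Proof.
move=> [fc cmin] [fc' c'min] i g.
have uu' p : u p = u' p.
  apply/eqP; rewrite -subr_eq0; apply/eqP; apply: small_eq0 => e e0.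
  have [|d d0] := near_min_close gN frame_diffs_mid (m := energy N u) e0.
    by move=> v [d fd]; exact: cmin fd.
  apply; [by exists c|by exists c'|by rewrite lerDl ltW|].
  by rewrite (le_trans (c'min _ _ fc))// lerDl ltW.
have [[c1 c2 c3] [d1 d2 d3]] := (fc, fc').
apply/eqP; rewrite -subr_eq0; apply/eqP; move: i.
apply: (gen_subgroup_full (H := [set g | forall i, c i g - c' i g = 0]) M_gen).
  apply: (@is_subgroup_forall _ (fun i => [set g | c i g - c' i g = 0])) => i.
  split=> /= [|a b ca cb]; first by rewrite !(limit_cocycle1 act)// subrr.
  rewrite !(limit_cocycleM act)// !(limit_cocycleV act)//.
  by rewrite (subr0_eq ca) (subr0_eq cb) subrr.
move=> h [j _ Mh] i /=.
have -> : c i h = pi h (u (i, j)) - u (i, j) by rewrite -c3 (c2 j h Mh) subr0.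
have -> : c' i h = pi h (u' (i, j)) - u' (i, j) by rewrite -d3 (d2 j h Mh) subr0.
by rewrite uu' subrr.
Qed.

Lemma frame_coboundary c u : frame alpha M c u ->
  forall g i, coboundary_sum alpha (c i g).
Proof.
move=> [c1 c2 c3].
apply: (gen_subgroup_full (H := [set g | forall i, coboundary_sum alpha (c i g)]) M_gen).
  apply: (@is_subgroup_forall _ (fun i => [set g | coboundary_sum alpha (c i g)])).
  by move=> i; exact: coboundary_sum_subgroup.
move=> h [j _ Mh] i /=; rewrite -[c i h]subr0 -(c2 j h Mh) c3.
exact: coboundary_sum1.
Qed.

(** The frame is moved by [alpha g^-1%g] and relabelled by [tau]; the energy is unchanged because
    [N] is invariant and the pairs of indices are only permuted. *)
Lemma frame_transport (phi : G -> G) g (tau : 'S_l) c u :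
  frame alpha M c u ->
  (forall i k, M (tau i) k -> c i (conj_by g (phi k)) = 0) ->
  let c' j k := pi g^-1%g (c ((tau^-1)%g j) (conj_by g (phi k))) in
  exists2 u', frame (fun k => alpha (phi k)) M c' u' & energy N u' = energy N u.
Proof.
move=> [c1 c2 c3] cM c'.
exists (fun p => pi g^-1%g (u ((tau^-1)%g p.1, (tau^-1)%g p.2))); first split.
- by move=> i; exact: limit_cocycle_transport.
- by move=> i k Mk; rewrite /c' cM ?(rep0 rep)// permKV.
- move=> i j k; rewrite /c' -(repB rep) c3 (repB rep) /=.
  rewrite -[linear_part (fun _ => _) k _]/(pi (phi k) _).
  by rewrite -!(repM rep) /conj_by !mulgA mulVg mul1g.
pose f (p : 'I_l * 'I_l) := (tau p.1, tau p.2).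
have f_inj : injective f by move=> [a b] [a' b'] [] /perm_inj -> /perm_inj ->.
rewrite /energy (reindex_inj f_inj)/=; apply: eq_bigr => -[a b] _.
by rewrite (unif_norm_inv uN) /= !permK.
Qed.

(* [h] maps the minimal frame to another one, hence moves its points by a
   vector which is fixed by [pi], and therefore zero. *)
Lemma frame_min_typeI c u h (tau : 'S_l) : frame_min N alpha M c u ->
  (forall i k, M (tau i) k -> c i (conj_by h^-1%g k) = 0) ->
  forall i, tau i = i -> c i h = 0.
Proof.
move=> cmin cM i tau_i; have [fc minc] := cmin.
have [u' fc' uu'] := frame_transport (phi := id) fc cM.
have c'min : frame_min N alpha M (fun j k =>
    pi h^-1^-1%g (c ((tau^-1)%g j) (conj_by h^-1%g k))) u'.
  by split=> [|d v fd]; [exact: fc'|rewrite uu'; exact: minc fd].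
apply: (coboundary_sum_fixed act uN); first exact: frame_coboundary fc _ _.
have [/(_ i) ci _ _] := fc.
move=> k; have := limit_cocycleM act k h ci.
(* Expanding [c i] on both products, and using uniqueness to recognize [c i k], leaves
   [pi k (c i h) = c i h]. *)
have -> : (k * h = h * conj_by h^-1 k)%g by rewrite /conj_by invgK !mulgA mulgV mul1g.
have := frame_min_unique cmin c'min i k.
rewrite invgK -{2}tau_i permK (limit_cocycleM act h (conj_by h^-1%g k) ci) => <-.
by rewrite addrC => /addrI.
Qed.

End OneAction.
Lemma frame_ker alpha M c u i : isometric_action alpha -> frame alpha M c u ->
  is_subgroup [set g | c i g = 0].
Proof.
move=> act [c1 _ _].
exact: (@limit_cocycle_ker _ _ _ alpha act (c i) (c1 i)).
Qed.

Section AllActions.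
Variables (alpha : G -> V -> V) (act : isometric_action alpha).
Variables (N : V -> R) (uN : unif_norm (linear_part alpha) N).
Variables (M : 'I_l -> set G) (M_gen : gen_subgroup (\bigcup_i M i) = [set: G]).
Variables (Pi : set (G -> G)) (Pi_fin : is_finite_Aut_subgroup Pi).

Definition twist (psi : G -> G) g x := alpha (psi g) x.

Hypothesis M_fixed :
  forall psi, Pi psi -> forall i, fixed_points (twist psi) (M i) !=set0.

Lemma Pi_aut psi : Pi psi -> {morph psi : g h / (g * h)%g}.
Proof. by move=> Ppsi; case: Pi_fin => _ PA _ _ _; case: (PA _ Ppsi). Qed.

Lemma Pi_inj psi : Pi psi -> injective psi.
Proof. by move=> Ppsi; case: Pi_fin => _ PA _ _ _; case: (PA _ Ppsi) => /bij_inj. Qed.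

Lemma morph1 (psi : G -> G) : {morph psi : g h / (g * h)%g} -> psi 1%g = 1%g.
Proof. by move=> psiM; apply: (@mulIg _ (psi 1%g)); rewrite -psiM !mul1g. Qed.

Lemma twist_act psi : Pi psi -> isometric_action (twist psi).
Proof.
move=> /Pi_aut psiM; case: act => a1 aM ai; split=> [x|g h x|g x y]; rewrite /twist.
- by rewrite (morph1 psiM).
- by rewrite psiM.
- exact: ai.
Qed.

Lemma twist_unif_norm psi : unif_norm (linear_part (twist psi)) N.
Proof. by case: uN => Ninv *; split=> // g x; exact: Ninv. Qed.

Lemma twist_frame_min psi : Pi psi -> exists c u, frame_min N (twist psi) M c u.
Proof.
move=> Ppsi.
apply: (frame_min_exists (twist_act Ppsi) (twist_unif_norm psi) M_gen).
exact: M_fixed.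
Qed.

(** The invariant of the game. All twists are treated together, since a type (II) move relates the
    minimal frames of [twist psi] to those of [twist (psi \o phi0)] with [phi0] in [Pi]. *)
Definition fixes_minimal_frames H : Prop :=
  forall psi, Pi psi -> forall c u, frame_min N (twist psi) M c u ->
    forall i h, H i h -> c i h = 0.

(* The powers of [phi] lie in the finite set [Pi], so one of them is trivial. *)
Lemma Pi_nondecreasing (D : (G -> G) -> R) phi psi : Pi phi -> Pi psi ->
  (forall chi, Pi chi -> D (chi \o phi) <= D chi) -> D psi <= D (psi \o phi).
Proof.
move=> Pphi Ppsi Dphi; have [Pfin _ Pid PM _] := Pi_fin.
have Piter n : Pi (iter n phi) by elim: n => //= n IH; exact: PM.
have [a [b [ab itab]]] : exists a b, (a < b)%N /\ iter a phi = iter b phi :> (G -> G).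
  apply: contrapT => nab; apply: infinite_nat.
  have -> : [set: nat] = (fun n => iter n phi : G -> G) @^-1` Pi.
    by apply/seteqP; split=> n // _; exact: Piter.
  apply: finite_preimage Pfin => a b _ _ iab.
  have [ab|ba|//] := ltngtP a b; exfalso; apply: nab.
    by exists a, b.
  by exists b, a.
have iter_inj n : injective (iter n phi).
  by elim: n => //= n IH g h /(Pi_inj Pphi)/IH.
have iter_id : iter (b - a) phi = id :> (G -> G).
  apply/funext => g; apply: (iter_inj a).
  by rewrite -iterD subnKC ?(ltnW ab)// -itab.
have Ppp : Pi (psi \o phi) by exact: PM.
have le_iter n : D ((psi \o phi) \o iter n phi) <= D (psi \o phi).
  elim: n => [|n IH]; first exact: lexx.
  have -> : (psi \o phi) \o iter n.+1 phi = ((psi \o phi) \o iter n phi) \o phi.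
    by apply/funext => g /=; rewrite -iterSr.
  by rewrite (le_trans (Dphi _ _))//; exact: PM.
rewrite (le_trans _ (le_iter (b - a).-1))// [X in _ <= D X](_ : _ = psi)//.
by apply/funext => g /=; rewrite -iterS prednK ?subn_gt0// iter_id.
Qed.

(** For type (II), transport preserves energy, so the minimal energy [D] does not increase under
    composition with [phi0]; finiteness of [Pi] makes it constant. Transported minimal frames are
    thus minimal, and the invariant applies to them. *)
Lemma fixes_minimal_frames_move H H' : game_move M Pi H H' ->
  fixes_minimal_frames H -> fixes_minimal_frames H'.
Proof.
have energy_min : exists D : (G -> G) -> R, forall psi c u, Pi psi ->
    frame_min N (twist psi) M c u -> D psi = energy N u.
  (* All minimal frames of one action have the same energy, so for [psi] in [Pi] this is the infimum
     of a singleton or of the empty set. *)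
  exists (fun psi => inf [set e | exists c u,
    frame_min N (twist psi) M c u /\ e = energy N u]).
  move=> psi c u Ppsi cmin; have [fc minc] := cmin.
  rewrite (_ : [set e | _] = [set energy N u]) ?inf1//.
  apply/seteqP; split=> [_ [d [v [[fd mind] ->]]]|_ ->] /=; last by exists c, u.
  by apply/eqP; rewrite eq_le (mind _ _ fc) (minc _ _ fd).
have [D DE] := energy_min.
have transport phi chi g (tau : 'S_l) c u :
    Pi phi -> Pi chi -> frame_min N (twist chi) M c u ->
    (forall i k, M (tau i) k -> c i (conj_by g (phi k)) = 0) ->
    exists2 u', frame (twist (chi \o phi)) M
        (fun j k => linear_part (twist chi) g^-1%g
          (c ((tau^-1)%g j) (conj_by g (phi k)))) u'
      & energy N u' = D chi.
  move=> Pphi Pchi cmin cM; have [fc _] := cmin; rewrite (DE _ _ _ Pchi cmin).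
  exact: (frame_transport (twist_act Pchi) (twist_unif_norm chi) fc cM).
case=> [tau P _ PM|sigma Lambda LPi LM] Hfix psi Ppsi c u cmin i;
  have [fc minc] := cmin; have act' := twist_act Ppsi; have uN' := twist_unif_norm psi.
- have ker := frame_ker i act' fc.
  case: ifPn => [/eqP taui|_]; last exact: (Hfix _ Ppsi _ _ cmin i).
  apply: smallest_sub => // h [Hh|Ph]; first exact: (Hfix _ Ppsi _ _ cmin i h Hh).
  apply: (frame_min_typeI act' uN' M_gen cmin _ taui) => j k /(PM h Ph)[k' Hk' <-].
  rewrite (_ : conj_by _ _ = k'); first exact: (Hfix _ Ppsi _ _ cmin _ _ Hk').
  by rewrite /conj_by invgK !mulgA mulVg mul1g -mulgA mulVg mulg1.
have ker := frame_ker i act' fc.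
apply: smallest_sub => // h [Hh|[phi Lphi [k Hk <-]]].
  exact: (Hfix _ Ppsi _ _ cmin i h Hh).
have [_ [g _ <-] [phi0 Pphi0 phiE]] := LPi _ Lphi.
have cM chi d v : Pi chi -> frame_min N (twist chi) M d v ->
    forall j m, M (sigma j) m -> d j (conj_by g (phi0 m)) = 0.
  move=> Pchi dmin j m Mm; apply: (Hfix chi Pchi d v dmin).
  by apply: (LM phi Lphi); exists m => //; rewrite -phiE.
have D_le chi : Pi chi -> D (chi \o phi0) <= D chi.
  move=> Pchi; have [d [v dmin]] := twist_frame_min Pchi.
  have [v' fv' <-] := transport phi0 chi g sigma d v Pphi0 Pchi dmin (cM _ _ _ Pchi dmin).
  have Pcp : Pi (chi \o phi0) by have [_ _ _ PM _] := Pi_fin; exact: PM.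
  have [d' [w dmin']] := twist_frame_min Pcp.
  by rewrite (DE _ _ _ Pcp dmin'); have [_] := dmin'; apply; exact: fv'.
have [v' fv' vE] := transport phi0 psi g sigma c u Pphi0 Ppsi cmin (cM _ _ _ Ppsi cmin).
have Pcp : Pi (psi \o phi0) by have [_ _ _ PM _] := Pi_fin; exact: PM.
have [d' [w dmin']] := twist_frame_min Pcp.
have vmin : frame_min N (twist (psi \o phi0)) M
    (fun j k => linear_part (twist psi) g^-1%g
      (c ((sigma^-1)%g j) (conj_by g (phi0 k)))) v'.
  split=> // e w' fe; rewrite vE (le_trans (Pi_nondecreasing Pphi0 Ppsi D_le))//.
  by rewrite (DE _ _ _ Pcp dmin'); have [_] := dmin'; apply; exact: fe.
(* The transported point of index [sigma i] is the original [i]-th point moved by [g^-1], so that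
   [k] fixing the former means that [phi k] fixes the latter. *)
have := Hfix _ Pcp _ _ vmin (sigma i) k Hk; rewrite permK -phiE /=.
move=> /eqP; rewrite -normr_eq0 (rep_norm (linear_part_rep act')) normr_eq0.
by move=> /eqP.
Qed.

Lemma fixes_minimal_frames_game K H :
  Relation_Operators.clos_refl_trans _ (game_move M Pi) K H ->
  fixes_minimal_frames K -> fixes_minimal_frames H.
Proof.
by elim=> [? ? /fixes_minimal_frames_move//|//|? ? ? _ + _ + /[dup]]; auto.
Qed.

(** The invariant holds initially by definition of a frame. At a winning position some [c i]
    vanishes on [G], and the points approximating it are almost fixed. *)
Lemma almost_fixed_points : game_winnable M Pi ->
  forall (F : seq G) (e : R), 0 < e ->
    exists x, forall g, g \in F -> `|alpha g x - x| <= e.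
Proof.
move=> [H [Hmoves [i Hi]]] F e e0.
have [_ _ Pid _ _] := Pi_fin.
have [c [u cmin]] := twist_frame_min Pid.
have c0 g : c i g = 0.
  apply: (fixes_minimal_frames_game Hmoves _ Pid cmin); last by rewrite Hi.
  by move=> psi _ d v [[_ + _] _] j h Mh; apply.
have [[cl _ _] _] := cmin.
have [x xP] := cl i F e e0; exists x => g gF.
by rewrite -normrN -[- _]add0r -(c0 g) xP.
Qed.

End AllActions.
End Game.

(** * The Gromov-Schoen argument in ultraproducts *)

Section Displacement.
Context {R : realType} {V : completeNormedModType R} {G : groupType}.
Variables (alpha : G -> V -> V) (act : isometric_action alpha) (S : seq G).

Definition displacement x : R := \sum_(g <- S) `|alpha g x - x|.

Lemma displacement_ge0 x : 0 <= displacement x.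
Proof. exact: sumr_ge0. Qed.

Lemma displacement_ge g x : g \in S -> `|alpha g x - x| <= displacement x.
Proof.
rewrite /displacement; elim: S => // h s IH; rewrite inE big_cons => /predU1P[->|/IH gs].
  by rewrite lerDl sumr_ge0.
by rewrite (le_trans gs)// lerDr.
Qed.

Lemma displacement_le x (c : R) : (forall g, g \in S -> `|alpha g x - x| <= c) ->
  displacement x <= (size S)%:R * c.
Proof.
rewrite /displacement mulr_natl; elim: S => [|g s IH] xc; first by rewrite big_nil.
rewrite big_cons /= mulrS lerD ?xc ?mem_head// IH// => h hs.
by rewrite xc// inE hs orbT.
Qed.

Lemma displacement_lipschitz x y :
  displacement x <= displacement y + (2 * size S)%:R * `|x - y|.
Proof.
rewrite /displacement natrM -mulrA mulrCA mulr_natl; case: act => _ _ ai.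
elim: S => [|g s IH]; first by rewrite !big_nil mulr0n addr0.
rewrite !big_cons /= mulrS addrACA lerD//.
rewrite (le_trans (ler_distD (alpha g y) _ _))// ai.
rewrite (le_trans (lerD (lexx _) (ler_distD y _ _)))// (distrC y x); lra.
Qed.

(* The Gromov-Schoen lemma: otherwise one could keep halving the displacement
   while moving along a sequence converging to a fixed point. *)
Lemma displacement_halving (n : nat) : (forall x, 0 < displacement x) ->
  exists x, forall y, `|y - x| <= n%:R * displacement x ->
    displacement x / 2 <= displacement y.
Proof.
move=> dpos; apply: contrapT => nx.
have /choice[f fP] x : exists y, `|y - x| <= n%:R * displacement x /\
    displacement y < displacement x / 2.
  apply: contrapT => ny; apply: nx; exists x => y yx.
  by rewrite leNgt; apply/negP => yx2; apply: ny; exists y.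
pose y k := iter k f 0.
have dy k : displacement (y k) * 2 ^+ k <= displacement (y 0%N).
  elim: k => [|k IH]; first by rewrite expr0 mulr1.
  have [_ /ltW H] := fP (y k); rewrite -/(y k.+1) in H.
  by rewrite exprS mulrA (le_trans _ IH)// ler_wpM2r ?exprn_ge0// -ler_pdivlMr.
(* Each step is at most [n] times the displacement, hence at most [2 * n] times the drop in
   displacement; the bounds telescope. *)
have y_dist k j : `|y (k + j)%N - y k| <=
    2 * n%:R * (displacement (y k) - displacement (y (k + j)%N)).
  elim: j => [|j IH]; first by rewrite addn0 !subrr normr0 mulr0.
  rewrite (le_trans (ler_distD (y (k + j)%N) _ _))// addnS.
  have [H1 /ltW H2] := fP (y (k + j)%N); rewrite -/(y (k + j).+1) in H1 H2.
  have := ler_wpM2l (ler0n R n) H2; lra.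
have d_small (e : R) : 0 < e -> exists K, forall k, (K <= k)%N -> displacement (y k) <= e.
  move=> e0; have [K KP] := pow2_gt (displacement (y 0%N)) e0.
  exists K => k Kk; rewrite -(ler_pM2r (exprn_gt0 k (ltr0Sn R 1))).
  rewrite (le_trans (dy k))// (le_trans (ltW KP))// mulrC ler_wpM2l ?(ltW e0)//.
  by rewrite ler_weXn2l// ler1n.
have y_cvg : cvg (y k @[k --> \oo]).
  apply: cauchy_seq_cvg => e e0.
  have [|K KP] := d_small (e / 2 / (2 * n%:R + 1)).
    by rewrite !divr_gt0// ltr_wpDl// mulr_ge0.
  have yK k : (K <= k)%N -> `|y k - y K| <= e / 2.
    move=> Kk; have := y_dist K (k - K)%N; rewrite subnKC// => /le_trans; apply.
    have := KP K (leqnn _); rewrite ler_pdivlMr ?ltr_wpDl ?mulr_ge0//.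
    have := displacement_ge0 (y K); have := displacement_ge0 (y k).
    have := ler0n R n; nra.
  exists K => i j Ki Kj; rewrite (le_trans (ler_distD (y K) _ _))// (distrC (y K)).
  by rewrite [e]splitr lerD// yK.
set z := lim (y k @[k --> \oo]) in y_cvg.
have := dpos z; apply/negP; rewrite -leNgt; apply/ler_addgt0Pr => e e0; rewrite add0r.
have [|K KP] := d_small (e / 2); first by rewrite divr_gt0.
have e' : 0 < e / 2 / (2 * size S).+1%:R by rewrite !divr_gt0.
move/cvgrPdist_le : y_cvg => /(_ _ e') y_cvg.
near \oo => k.
have Kk : (K <= k)%N by near: k; exact: nbhs_infty_ge.
have zk : `|z - y k| <= e / 2 / (2 * size S).+1%:R by near: k.
rewrite (le_trans (displacement_lipschitz z (y k)))// [e]splitr lerD ?KP//.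
move: zk; rewrite ler_pdivlMr// => /(le_trans _); apply.
by rewrite mulrC ler_wpM2l// ler_nat.
Unshelve. all: by end_near. Qed.

End Displacement.

Lemma nonprincipal_ultra_ge (U : set_system nat) : UltraFilter U ->
  (forall n, U <> principal_filter n) -> forall n, U [set k | (n <= k)%N].
Proof.
move=> UF Unp; suff noU n : ~ U [set k | (k < n)%N].
  move=> n; have [//|Un] := in_ultra_setVsetC [set k | (n <= k)%N] UF.
  by case: (noU n); apply: filterS Un => k /= /negP; rewrite -ltnNge.
elim: n => [/filter_ex[k]//|n IH Un].
have [Uk|nUk] := in_ultra_setVsetC [set n] UF.
  apply: (Unp n); apply/seteqP; split=> A /=.
    by move=> UA _ ->; have [k [/= Ak <-]] := filter_ex (filterI UA Uk).
  by move=> nA; apply: filterS Uk => k /= ->; exact: nA.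
apply: IH; apply: filterS (filterI Un nUk) => k /= [kn /eqP nk].
by rewrite ltn_neqAle nk -ltnS.
Qed.

Section UltraproductAction.
Context {R : realType} {G : groupType} {X : nat -> normedModType R}.
Variables (U : set_system nat) (UF : UltraFilter U) (w : forall n, X n).
Variable alpha : forall n, G -> X n -> X n.
Hypothesis act : forall n, isometric_action (@alpha n).
Hypothesis bounded : forall g, exists r : R, forall n, `|alpha g (w n) - w n| <= r.
Local Notation Z := (ultraproduct UF w).
Local Open Scope quotient_scope.

Lemma act_bounded g (x : bounded_seq w) :
  exists r : R, forall n, `|alpha g (x n) - w n| <= r.
Proof.
have [[r rP] [s sP]] := (bounded g, bounded_seqP x); exists (s + r) => n.
rewrite (le_trans (ler_distD (alpha g (w n)) _ _))// lerD//.
by have [_ _ ->] := act n.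
Qed.

Definition seq_act g (x : bounded_seq w) : bounded_seq w := BoundedSeq (act_bounded g x).

Lemma seq_act_dist g x y :
  ultra_semidist U (seq_act g x) (seq_act g y) = ultra_semidist U x y.
Proof.
rewrite /ultra_semidist; congr (lim (_ @ U)); apply/funext => n /=.
by have [_ _ ->] := act n.
Qed.

Lemma ultra_pi_ext (x y : bounded_seq w) : (forall n, x n = y n) -> \pi_Z x = \pi_Z y.
Proof.
move=> xy; apply/ultra_piP; rewrite -(ultra_semidistxx UF y) /ultra_semidist.
by congr (lim (_ @ U)); apply/funext => n; rewrite xy.
Qed.

Definition ultra_act g (z : Z) : Z := \pi_Z (seq_act g (repr z)).

Lemma ultra_act_pi g (x : bounded_seq w) : ultra_act g (\pi_Z x) = \pi_Z (seq_act g x).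
Proof.
apply/ultra_piP; rewrite seq_act_dist; apply/ultra_piP.
exact: reprK.
Qed.

Lemma ultra_act1 z : ultra_act 1%g z = z.
Proof.
rewrite -[RHS]reprK; apply: ultra_pi_ext => n /=.
by have [-> _ _] := act n.
Qed.

Lemma ultra_actM g h z : ultra_act (g * h)%g z = ultra_act g (ultra_act h z).
Proof.
rewrite [in RHS]/ultra_act -/(ultra_act g _) ultra_act_pi.
apply: ultra_pi_ext => n /=.
by have [_ -> _] := act n.
Qed.

Lemma ultra_act_dist g z z' : mdist (ultra_act g z) (ultra_act g z') = mdist z z'.
Proof. by rewrite /mdist/= ultra_dist_pi seq_act_dist -ultra_dist_pi !reprK. Qed.

End UltraproductAction.

(** Without a fixed point, rescaling around the points [x n] of [displacement_halving] gives actions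
    with displacement [1] at [w n] and at least [1 / 2] on the ball of radius [n]. Their
    ultraproduct is isometric to a space of the class, where almost fixed points contradict this
    bound. *)
Lemma almost_fixed_points_fixed (R : realType) (E : completeNormedModType R -> Prop)
  (E_ultra : ultraproduct_stable E) (G : groupType) (G_fg : finitely_generated G) :
  (forall V, E V -> forall alpha : G -> V -> V, isometric_action alpha ->
    forall (F : seq G) (e : R), 0 < e ->
      exists x, forall g, g \in F -> `|alpha g x - x| <= e) ->
  property_F E G.
Proof.
move=> almost V EV alpha act; apply: contrapT => nofix.
have [A /finite_seqP[S ->] S_gen] := G_fg.
have dpos x : 0 < displacement alpha S x.
  rewrite lt_neqAle displacement_ge0 andbT eq_sym; apply/negP => /eqP dx.
  apply: nofix; exists x => g _; move: g.
  apply: (gen_subgroup_full (H := [set g | alpha g x = x]) S_gen).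
    split=> /= [|g h gx hx]; first by case: act.
    have [a1 aM _] := act; rewrite aM (_ : alpha h^-1%g x = x)//.
    by rewrite -{1}hx -aM mulVg a1.
  move=> g gS /=; apply/eqP; rewrite -subr_eq0 -normr_le0 -dx.
  exact: displacement_ge.
have /choice[x xP] := fun n => displacement_halving act n dpos.
pose lam n := (displacement alpha S (x n))^-1.
have lam0 n : 0 < lam n by rewrite invr_gt0.
pose al n g (y : V) : V := lam n *: alpha g ((lam n)^-1 *: y).
have lamK n (y : V) : (lam n)^-1 *: (lam n *: y) = y.
  by rewrite scalerA mulVf ?scale1r// gt_eqF.
have lamVK n (y : V) : lam n *: ((lam n)^-1 *: y) = y.
  by rewrite scalerA divff ?scale1r// gt_eqF.
have al_act n : isometric_action (al n).
  have [a1 aM ai] := act; split=> [y|g h y|g y z]; rewrite /al.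
  - by rewrite a1 lamVK.
  - by rewrite lamK aM.
  - by rewrite -scalerBr normrZ ai -normrZ scalerBr !lamVK.
pose w n : V := lam n *: x n.
have al_dist n g (y : V) :
    `|al n g y - y| = lam n * `|alpha g ((lam n)^-1 *: y) - (lam n)^-1 *: y|.
  by rewrite -{2}(lamVK n y) -scalerBr normrZ gtr0_norm.
have bounded : forall g, exists r : R, forall n, `|al n g (w n) - w n| <= r.
  apply: (gen_subgroup_full
    (H := [set g | exists r : R, forall n, `|al n g (w n) - w n| <= r]) S_gen).
    split=> /= [|g h [r rP] [s sP]].
      by exists 0 => n; have [-> _ _] := al_act n; rewrite subrr normr0.
    exists (s + r) => n; rewrite (le_trans (ler_distD (al n g (w n)) _ _))// lerD//.
    have [a1 aM ai] := al_act n.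
    by rewrite aM ai -(ai h) -aM mulgV a1 distrC.
  move=> g gS /=; exists 1 => n; rewrite al_dist lamK mulrC ler_pdivrMr// mul1r.
  exact: displacement_ge.
have [U [UF [Unp /(_ (fun=> V) (fun=> EV) w)[B EB [f [f' fK f'K] f_iso]]]]] := E_ultra.
pose be g b := f (ultra_act al_act bounded g (f' b)).
have be_act : isometric_action be.
  split=> [b|g h b|g b b']; rewrite /be.
  - by rewrite ultra_act1 f'K.
  - by rewrite fK ultra_actM.
  - by rewrite f_iso ultra_act_dist -f_iso !f'K.
(* On a [U]-large set each generator moves [y n] by at most [e + e], which sums to less than
   [1 / 2]; the successor also covers an empty [S]. *)
pose e : R := 4^-1 / (size S).+1%:R.
have e0 : 0 < e by rewrite divr_gt0.
have [b bP] := almost B EB be be_act S e e0.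
pose y := repr (f' b); have [r yr] := bounded_seqP y.
have yP g : g \in S -> ultra_semidist U (seq_act al_act bounded g y) y <= e.
  move=> /bP; rewrite -{2}(f'K b) f_iso -{2}(reprK (f' b)).
  by rewrite /mdist/= ultra_dist_pi.
have y_small : U [set n | forall g, g \in S -> `|al n g (y n) - y n| <= e + e].
  elim: (S) yP => [|g s IH] yP; first by apply: filterE => n g.
  have Hs := IH (fun h hs => yP h (@mem_behead _ (g :: s) h hs)).
  have := @ultra_semidist_cvg _ _ _ UF _ (seq_act al_act bounded g y) y.
  move=> /cvgrPdist_le/(_ e e0) Hg.
  apply: filterS (filterI Hs Hg) => n [/= Hn gn] h; rewrite inE => /predU1P[->|/Hn//].
  have := yP g (mem_head _ _); move: gn; rewrite ler_norml; lra.
(* [k] bounds the distance from [y] to the base point; an index [n >= k] is available because [U]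
   contains every tail. *)
have [k kr] : exists k : nat, r <= k%:R.
  by exists (Num.truncn r).+1; exact/ltW/truncnS_gt.
have [n [/= yn kn]] := filter_ex (filterI y_small (nonprincipal_ultra_ge UF Unp k)).
have dn := dpos (x n).
have /xP : `|(lam n)^-1 *: y n - x n| <= n%:R * displacement alpha S (x n).
  rewrite -(lamK n (x n)) -/(w n) -scalerBr normrZ gtr0_norm ?invr_gt0// lamK invrK mulrC.
  by rewrite ler_wpM2r ?(ltW dn)// (le_trans (yr n))// (le_trans kr)// ler_nat.
apply/negP; rewrite -ltNge.
rewrite (@le_lt_trans _ _ ((size S)%:R * (displacement alpha S (x n) * (e + e))))//.
  apply: displacement_le => g gS; have := yn g gS.
  by rewrite al_dist /lam mulrC ler_pdivrMr// [leRHS]mulrC.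
have eS : e * (size S).+1%:R = 4^-1 by rewrite divfK.
rewrite -natr1 in eS; move: (size S)%:R eS => s eS.
have : 0 < displacement alpha S (x n) * e by rewrite mulr_gt0.
nra.
Qed.

(** * From winning either game to property (F) *)

Lemma game_winnable_property_F (R : realType) (E : completeNormedModType R -> Prop)
  (G : groupType) (Pi : set (G -> G)) (l : nat) (M : 'I_l -> set G) :
  (forall V, E V -> superreflexive V) -> ultraproduct_stable E ->
  finitely_generated G -> is_finite_Aut_subgroup Pi ->
  gen_subgroup (\bigcup_i M i) = [set: G] -> game_winnable M Pi ->
  (forall i, relative_property_F E (M i)) -> property_F E G.
Proof.
move=> E_sr E_ultra G_fg Pi_fin M_gen win relF.
apply: almost_fixed_points_fixed => // V EV alpha act.
have [N uN] := superreflexive_unif_norm (linear_part_rep act) (E_sr V EV).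
apply: (almost_fixed_points act uN M_gen Pi_fin _ win) => psi Ppsi i.
exact/(relF i V EV)/(twist_act act Pi_fin).
Qed.

(** A type (I) move for two subgroups is the general one with [tau] the identity; for type (II) the
    two conditions agree after reindexing by [sigma]. *)
Lemma game2_move_game_move (G : groupType) (K : 'I_2 -> set G) (Pi : set (G -> G))
  (H H' : 'I_2 -> set G) : game2_move K Pi H H' -> game_move K Pi H H'.
Proof.
case=> [P HP|sigma Lambda LPi LK].
  rewrite (_ : (fun i => _) =
    fun i => if (1 : 'S_2)%g i == i then gen_subgroup (H i `|` P) else H i).
    by apply: GameI; [exists ord0; rewrite perm1|move=> h Ph i; rewrite perm1; exact: HP].
  by apply/funext => i; rewrite perm1 eqxx.
by apply: GameII => // phi Lphi i; have := LK phi Lphi (sigma i); rewrite permK.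
Qed.

Lemma clos_refl_trans_mono (T : Type) (r r' : T -> T -> Prop) x y :
  (forall a b, r a b -> r' a b) -> Relation_Operators.clos_refl_trans T r x y ->
  Relation_Operators.clos_refl_trans T r' x y.
Proof.
move=> rr'; elim=> [a b /rr'|a|a b c _ + _].
- exact: Relation_Operators.rt_step.
- exact: Relation_Operators.rt_refl.
- exact: Relation_Operators.rt_trans.
Qed.

Theorem theorem4 (R : realType) (E : completeNormedModType R -> Prop)
    (E_superreflexive : forall V, E V -> superreflexive V)
    (E_ultra : ultraproduct_stable E)
    (G : groupType) (G_fg : finitely_generated G)
    (Pi : set (G -> G)) (Pi_fin : is_finite_Aut_subgroup Pi) :
  (forall M L : set G, is_subgroup M -> is_subgroup L ->
     gen_subgroup (M `|` L) = [set: G] ->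
     game2_winnable M L Pi ->
     relative_property_F E M -> relative_property_F E L ->
     property_F E G)
  /\
  (forall (l : nat) (M : 'I_l -> set G), (3 <= l)%N ->
     (forall i, is_subgroup (M i)) ->
     gen_subgroup (\bigcup_i M i) = [set: G] ->
     game_winnable M Pi ->
     (forall i, relative_property_F E (M i)) ->
     property_F E G).
Proof.
split=> [M L _ _ ML_gen [H [moves Hwin]] relM relL|l M _ _ M_gen win relF]; last first.
  exact: game_winnable_property_F M_gen win relF.
apply: (@game_winnable_property_F _ _ _ Pi 2 (set_pair M L)) => //.
- have ML : \bigcup_i set_pair M L i = M `|` L.
    apply/seteqP; split=> [g [i _]|g [Mg|Lg]].
    + by rewrite /set_pair; case: ifP => _ ?; [left|right].
    + by exists ord0.
    + by exists (lift ord0 ord0).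
  by rewrite ML.
- exists H; split=> //; apply: clos_refl_trans_mono moves.
  exact: game2_move_game_move.
- by move=> i; rewrite /set_pair; case: ifP.
Qed.
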